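(* Let $J\in\mathcal{J}$ be a concentrated black component and $B=U(J)$, and assume there exists a vector $z^B$ satisfying the configuration constraints for $B$. Then one can find a probability distribution $\phi=(\phi_{S,\beta})$ over pairs $(S,\beta)$ with $S\subseteq B$, $\beta\in\mathbb{R}_{\ge0}^B$ such that: (1) $s_\phi:=\mathbb{E}_{(S,\beta)\sim\phi}|S|\in[y_B,\,y_B(1+2\ell\pi_J/x_{B,C})]$, and $s_\phi=y_B$ if $y_B>2\ell$; and for every $(S,\beta)$ in the support of $\phi$: (2) $|S|\in\{\lfloor s_\phi\rfloor,\lceil s_\phi\rceil\}$; (3) $\beta_i\le(1+O(1/\ell))u_i$ for $i\in S$ and $\beta_i=0$ for $i\in B\setminus S$; (4) $\sum_{i\in S}\beta_i=x_{B,C}=\sum_{v\in J}\alpha_v$; moreover (5) the support of $\phi$ has size at most $n^{O(\ell)}$, where $n=|F|+|C|$; (6) $\mathbb{E}_{(S,\beta)\sim\phi}\,\mathrm{EMD}_J(\alpha|_J,\beta)\le O(\ell^4)D_B$.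
   Context: Instance: finite facility set $F$ with capacities $u_i\in\mathbb{Z}_{>0}$, finite client set $C$, metric $d$ on $F\cup C$, integer $k$. Fix a feasible basic-LP solution $(x,y)$: $\sum_i y_i\le k$, $\sum_i x_{i,j}=1$ ($j\in C$), $x_{i,j}\le y_i$, $\sum_j x_{i,j}\le u_iy_i$, $0\le x,y\le1$. Notation: $d_{\mathsf{av}}(j)=\sum_i x_{i,j}d(i,j)$; $D_i=\sum_j x_{i,j}(d(i,j)+d_{\mathsf{av}}(j))$, $D_S=\sum_{i\in S}D_i$; $x_{F',C'}=\sum_{i\in F',j\in C'}x_{i,j}$; $y_{F'}=\sum_{i\in F'}y_i$; $d(A,B)=\min_{a\in A,b\in B}d(a,b)$. Parameters: $\ell$ is a sufficiently large integer, $\ell_1=\Theta(\ell)$ and $\ell_2=\Theta(\ell^3)$ are integers with sufficiently large hidden constants; all $O(\cdot)$ hide constants independent of the instance and of $\ell$. Representatives: start with $R=\emptyset$, $C'=C$; while $C'\neq\emptyset$ pick $v\in C'$ minimizing $d_{\mathsf{av}}(v)$, add it to $R$, remove from $C'$ all $j$ with $d(j,v)\le4d_{\mathsf{av}}(j)$. Each $i\in F$ goes to $U_v$ for a closest $v\in R$ (ties arbitrary); $U(V)=\bigcup_{v\in V}U_v$. $J\subseteq R$ is big if $y_{U(J)}\ge\ell$, small otherwise. Run Kruskal's algorithm on the complete graph on $R$ with lengths $d$; an edge added while merging two parts is black if both parts are small; black components are maximal subsets of $R$ connected by black MST edges, $\mathcal{J}$ is their set. $L(J)=d(J,R\setminus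 J)$, $\pi_J=\sum_{j\in C}x_{U(J),j}(1-x_{U(J),j})$; $J$ is concentrated if $\pi_J\le x_{U(J),C}/\ell_2$. Demands: $\alpha_v=x_{U_v,C}$ for $v\in R$; $\alpha|_V$ is the restriction to $V$. Earth mover distance: for $V\subseteq R$, $B=U(V)$, $\alpha'\in\mathbb{R}^V_{\ge0}$, $\beta\in\mathbb{R}^B_{\ge0}$ with $\sum_v\alpha'_v\le\sum_i\beta_i$, $\mathrm{EMD}_V(\alpha',\beta)=\inf_f\sum_{v\in V,i\in B}f(v,i)d(v,i)$ over $f:V\times B\to\mathbb{R}_{\ge0}$ with $\sum_{i}f(v,i)=\alpha'_v$ for all $v$ and $\sum_v f(v,i)\le\beta_i$ for all $i$. Configuration constraints for $B$: let $\mathcal{S}=\{S\subseteq B:|S|\le\ell_1\}$, $\tilde{\mathcal{S}}=\mathcal{S}\cup\{\bot\}$, where $\bot$ is treated as a set containing every $i\in B$. Variables $z^B_S$ ($S\in\tilde{\mathcal{S}}$), $z^B_{S,i}$ ($S\in\tilde{\mathcal{S}},i\in S$), $z^B_{S,i,j}$ ($S\in\tilde{\mathcal{S}},i\in S,j\in C$) must satisfy: $\sum_{S\in\tilde{\mathcal{S}}}z^B_S=1$; $\sum_{S\ni i}z^B_{S,i}=y_i$ for $i\in B$; $\sum_{S\ni i}z^B_{S,i,j}=x_{i,j}$ for $i\in B,j\in C$; $0\le z^B_{S,i,j}\le z^B_{S,i}\le z^B_S$; $z^B_{S,i}=z^B_S$ for $S\in\mathcal{S},i\in S$; $\sum_{i\in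 S}z^B_{S,i,j}\le z^B_S$ for $S\in\tilde{\mathcal{S}},j\in C$; $\sum_{j\in C}z^B_{S,i,j}\le u_iz^B_{S,i}$ for $S\in\tilde{\mathcal{S}},i\in S$; $\sum_{i\in B}z^B_{\bot,i}\ge\ell_1z^B_\bot$. *)

(* Defs.v *)
From mathcomp Require Import all_boot all_order all_algebra.
From mathcomp Require Import finmap.
From mathcomp Require Import boolp classical_sets reals.
(* finset is imported last so that [set0], [setT], ... denote finite sets. *)
From mathcomp Require Import finset.

Set Implicit Arguments.
Unset Strict Implicit.
Unset Printing Implicit Defensive.

Import Order.TTheory GRing.Theory Num.Theory.
Local Open Scope ring_scope.

(* Facilities and clients are finite sets of points that may overlap.  The
   metric axioms are only required on F :|: C; T is an ambient index type. *)
Record instance (R : realType) (T : finType) := Instance {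
  facilities : {set T};
  clients : {set T};
  capacity : T -> nat;
  dist : T -> T -> R;
  budget : int;
  capacity_gt0 : {in facilities, forall i, (0 < capacity i)%N};
  dist_ge0 : {in facilities :|: clients &, forall a b, 0 <= dist a b};
  dist_eq0 : {in facilities :|: clients &,
                forall a b, dist a b = 0 <-> a = b};
  dist_sym : {in facilities :|: clients &,
                forall a b, dist a b = dist b a};
  dist_triangle : {in facilities :|: clients & &,
                forall a b c, dist a c <= dist a b + dist b c}
}.

Section Notions.

Variables (R : realType) (T : finType) (I : instance R T).
Variables (x : T -> T -> R) (y : T -> R).

Local Notation F := (facilities I).
Local Notation C := (clients I).
Local Notation d := (dist I).
Local Notation u := (capacity I).

Definition basic_LP_feasible : Prop :=
  [/\ \sum_(i in F) y i <= (budget I)%:~R,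
      {in C, forall j, \sum_(i in F) x i j = 1},
      {in F & C, forall i j, x i j <= y i},
      {in F, forall i, \sum_(j in C) x i j <= (u i)%:R * y i} &
      {in F & C, forall i j, 0 <= x i j <= 1} /\
      {in F, forall i, 0 <= y i <= 1}].

Definition d_av (j : T) : R := \sum_(i in F) x i j * d i j.

Definition D_of (i : T) : R := \sum_(j in C) x i j * (d i j + d_av j).

Definition D_set (S : {set T}) : R := \sum_(i in S) D_of i.

Definition x_set (F' C' : {set T}) : R := \sum_(i in F') \sum_(j in C') x i j.

Definition y_set (F' : {set T}) : R := \sum_(i in F') y i.

(* [rep_state Rs C'] : the pair (representatives so far, remaining clients)
   is reachable in the greedy procedure, for some way of breaking ties. *)
Inductive rep_state : {set T} -> {set T} -> Prop :=
| rep_start : rep_state set0 C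
| rep_step (Rs C' : {set T}) (v : T) :
    rep_state Rs C' ->
    v \in C' ->
    {in C', forall j, d_av v <= d_av j} ->
    rep_state (v |: Rs) (C' :\: [set j in C' | d j v <= 4 * d_av j]).

Definition is_representatives (Rs : {set T}) : Prop := rep_state Rs set0.

(* [near i] is the representative v with i in U_v. *)
Definition is_closest_rep (Rs : {set T}) (near : T -> T) : Prop :=
  {in F, forall i, near i \in Rs /\ {in Rs, forall w, d i (near i) <= d i w}}.

Definition U (near : T -> T) (V : {set T}) : {set T} :=
  [set i in F | near i \in V].

Definition is_big (l : nat) (near : T -> T) (J : {set T}) : bool :=
  l%:R <= y_set (U near J).

Definition is_small (l : nat) (near : T -> T) (J : {set T}) : bool :=
  ~~ is_big l near J.

(* [es] lists the edges of the complete graph on Rs, each once and in one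
   arbitrary orientation, by nondecreasing length. *)
Definition is_edge_order (Rs : {set T}) (es : seq (T * T)) : Prop :=
  [/\ uniq es,
      sorted (fun e e' : T * T => d e.1 e.2 <= d e'.1 e'.2) es,
      {in es, forall e, [/\ e.1 \in Rs, e.2 \in Rs & e.1 != e.2]} &
      {in Rs &, forall v w, v != w ->
         ((v, w) \in es) (+) ((w, v) \in es)}].

(* The state is the current partition of Rs and the list of black edges. *)
Definition kruskal_step (l : nat) (near : T -> T)
    (st : {set {set T}} * seq (T * T)) (e : T * T) :
    {set {set T}} * seq (T * T) :=
  let: (P, black) := st in
  let V := pblock P e.1 in
  let W := pblock P e.2 in
  if V == W then st
  else ((V :|: W) |: (P :\: [set V; W]),
        if is_small l near V && is_small l near W then e :: black else black).

Definition kruskal (l : nat) (near : T -> T) (Rs : {set T})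
    (es : seq (T * T)) : {set {set T}} * seq (T * T) :=
  foldl (kruskal_step l near) ([set [set v] | v in Rs], [::]) es.

Definition black_edge (l : nat) (near : T -> T) (Rs : {set T})
    (es : seq (T * T)) : rel T :=
  fun v w => let black := (kruskal l near Rs es).2 in
             ((v, w) \in black) || ((w, v) \in black).

Definition black_components (l : nat) (near : T -> T) (Rs : {set T})
    (es : seq (T * T)) : {set {set T}} :=
  [set [set w in Rs | connect (black_edge l near Rs es) v w] | v in Rs].

Definition pi_set (near : T -> T) (J : {set T}) : R :=
  \sum_(j in C) x_set (U near J) [set j] * (1 - x_set (U near J) [set j]).

Definition concentrated (l2 : nat) (near : T -> T) (J : {set T}) : Prop :=
  pi_set near J <= x_set (U near J) C / l2%:R.

Definition alpha (near : T -> T) (v : T) : R := x_set (U near [set v]) C.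

(* Only the values of [a] on V, of [b] on U(V) and of [f] on V x U(V)
   matter. *)
Definition is_transport (near : T -> T) (V : {set T}) (a b : T -> R)
    (f : T -> T -> R) : Prop :=
  let B := U near V in
  [/\ {in V & B, forall v i, 0 <= f v i},
      {in V, forall v, \sum_(i in B) f v i = a v} &
      {in B, forall i, \sum_(v in V) f v i <= b i}].

Definition EMD (near : T -> T) (V : {set T}) (a b : T -> R) : R :=
  inf [set c | exists2 f : T -> T -> R, is_transport near V a b f &
               c = \sum_(v in V) \sum_(i in U near V) f v i * d v i]%classic.

(* [Some S] is the set S and [None] is bottom; [odflt B S] is the set of
   facilities that S contains, namely B when S is bottom. *)
Definition configs (l1 : nat) (B : {set T}) : {set option {set T}} :=
  [set S : option {set T} |
     if S is Some S' then (S' \subset B) && (#|S'| <= l1)%N else true].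

Definition config_feasible (l1 : nat) (B : {set T})
    (z : option {set T} -> R) (zi : option {set T} -> T -> R)
    (zij : option {set T} -> T -> T -> R) : Prop :=
  [/\ \sum_(S in configs l1 B) z S = 1,
      {in B, forall i,
         \sum_(S in configs l1 B | i \in odflt B S) zi S i = y i},
      {in B & C, forall i j,
         \sum_(S in configs l1 B | i \in odflt B S) zij S i j = x i j} &
  [/\ {in configs l1 B, forall S, {in odflt B S & C, forall i j,
         0 <= zij S i j /\ zij S i j <= zi S i /\ zi S i <= z S}},
      forall S : {set T}, Some S \in configs l1 B ->
        {in S, forall i, zi (Some S) i = z (Some S)},
      {in configs l1 B & C, forall S j,
         \sum_(i in odflt B S) zij S i j <= z S},
      {in configs l1 B, forall S, {in odflt B S, forall i,
         \sum_(j in C) zij S i j <= (u i)%:R * zi S i}} &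
      l1%:R * z None <= \sum_(i in B) zi None i]].

End Notions.

Section FiniteDistributions.

Variables (R : realType) (A : choiceType).

Definition is_distribution (phi : {fsfun A -> R with 0}) : Prop :=
  (forall a, 0 <= phi a) /\ \sum_(a <- finsupp phi) phi a = 1.

Definition expectation (phi : {fsfun A -> R with 0}) (g : A -> R) : R :=
  \sum_(a <- finsupp phi) phi a * g a.

End FiniteDistributions.

(* Main.v *)
(* The distribution needs only two atoms: a solution with t = floor s open facilities,
   of mass t + 1 - s, and one with t + 1, of mass s - t.

   If y_B > 2l then J is a single representative, so the transport cost is linear in
   the loads. Rescaling (y, x) to an integral number n of facilities costs a factor
   1 + O(1/l) in the capacities. Three-coordinate exchanges leave at most two
   fractional facilities, whose openings sum to 1, and these merge into one.

   If y_B <= 2l, view z^B as a random configuration S. Routing the demand of J to S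
   through the clients serves all but pi_J of it on average, at expected cost
   O(D_B); the rest travels at most diam J = O(l) L(J), and L(J) pi_J = O(D_B).
   Discard the configurations that serve less than (1 - 1/l) x_{B,C}; this is where
   the factor 1 + 2 l pi_J / x_{B,C} comes from. By Markov's inequality a fraction at
   least (n + 1 - s) / (n + 1) of the remaining ones open at most n facilities, so
   the best of them is affordable for its mass; it is padded with unused facilities. *)
Require Import Defs.
From mathcomp Require Import all_boot all_order all_algebra.
From mathcomp Require Import finmap.
From mathcomp Require Import boolp classical_sets reals.
From mathcomp Require Import finset.
From mathcomp Require Import ring lra.

Set Implicit Arguments.
Unset Strict Implicit.
Unset Printing Implicit Defensive.

Import Order.TTheory GRing.Theory Num.Theory.
Local Open Scope ring_scope.

(** * Representatives and black components *)

Section Representatives.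

Variables (R : realType) (T : finType) (I : instance R T).
Variables (x : T -> T -> R) (y : T -> R).

Local Notation F := (facilities I).
Local Notation C := (clients I).
Local Notation d := (dist I).
Local Notation dav := (d_av I x).

(** The threshold 2l comes from the merging rule: a black edge joins two small parts, so a component
    with at least two representatives has y-value below 2l. In the other regime the difficulty is
    that s must be met exactly although only its floor and ceiling are allowed as sizes. The atom of
    size t may have tiny mass t + 1 - s, and a choice of at most t facilities may then be dearer
    than average by a factor (t + 1) / (t + 1 - s); the mass cancels exactly this denominator. Size
    t + 1 needs no such cancellation, because t + 2 - s > 1. The cost is thus only quadratic in l:
    one factor l is the number of facilities in Markov's inequality, the other is the diameter of J
    in units of L(J). Concentration keeps l pi_J / x_{B,C} below 1/2, so at least half of the mass
    survives the discarding. The bottom configuration counts as l1 facilities, more than any size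
    asked for, and is therefore never chosen. *)

Lemma dist_xx a : a \in F :|: C -> d a a = 0.
Proof. by move=> aFC; apply/(dist_eq0 aFC aFC). Qed.

(** Representatives are picked in nondecreasing order of [dav]: a later [v] is more than [4 * dav v]
    away from each earlier [w], and [dav w <= dav v] makes the separation valid from both ends. The
    fourth clause carries this over to the clients still waiting. *)
Lemma rep_state_inv Rs C' : rep_state I x Rs C' ->
  [/\ Rs \subset C, C' \subset C,
      {in C, forall j, j \notin C' -> exists2 v, v \in Rs & d j v <= 4 * dav j},
      {in Rs & C', forall v j, dav v <= dav j /\ 4 * dav j < d j v} &
      {in Rs &, forall v w, v != w -> 4 * dav v < d v w}].
Proof.
elim=> [|{}Rs {}C' v st [RsC C'C cov sep pw] vC' vmin].
  split=> //; first exact: sub0set.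
  - by move=> j ->.
  - by move=> ? ?; rewrite inE.
  - by move=> ? ?; rewrite inE.
have vC : v \in C by apply: (fintype.subsetP C'C).
split.
- by apply/fintype.subsetP=> w; rewrite !inE => /predU1P[->//|/(fintype.subsetP RsC)].
- by apply/fintype.subsetP=> w; rewrite !inE => /andP[_ /(fintype.subsetP C'C)].
- move=> j jC; rewrite !inE negb_and negbK => /orP[/andP[_ dj]|jC'].
    by exists v => //; rewrite !inE eqxx.
  have [w wRs dw] := cov _ jC jC'; exists w => //.
  by rewrite !inE wRs orbT.
- move=> w j; rewrite !inE => /predU1P[->|wRs] /andP[+ jC'].
    by rewrite jC' /= -ltNge => dj; split=> //; apply: vmin.
  by move=> _; apply: sep.
have FC w : w \in C -> w \in F :|: C by move=> wC; rewrite inE wC orbT.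
move=> w w'; rewrite !inE => /predU1P[->|wRs] /predU1P[->|w'Rs] neq.
- by rewrite eqxx in neq.
- by have [_] := sep _ _ w'Rs vC'.
- have [le lt] := sep _ _ wRs vC'.
  rewrite (dist_sym (FC _ _) (FC _ _)) //; last exact: (fintype.subsetP RsC).
  by apply: le_lt_trans lt; rewrite ler_wpM2l.
- exact: pw.
Qed.

Lemma representativesP Rs : is_representatives I x Rs ->
  [/\ Rs \subset C,
      {in C, forall j, exists2 v, v \in Rs & d j v <= 4 * dav j} &
      {in Rs &, forall v w, v != w -> 4 * dav v < d v w}].
Proof.
move=> /rep_state_inv[RsC _ cov _ pw]; split=> // j jC.
by apply: cov => //; rewrite inE.
Qed.

Lemma closest_rep_dist Rs near : is_representatives I x Rs ->
  is_closest_rep I Rs near ->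
  {in F & C, forall i j, d i (near i) <= d i j + 4 * dav j}.
Proof.
move=> /representativesP[RsC cov _] cl i j iF jC.
have [v vRs dv] := cov _ jC.
have [_ /(_ _ vRs) le] := cl _ iF.
have vC := fintype.subsetP RsC _ vRs.
apply: (le_trans le).
have := @dist_triangle _ _ I i j v; rewrite !inE iF jC vC !orbT.
by move=> /(_ isT isT isT); move: dv; lra.
Qed.

(** Markov's inequality at the client [v]: a facility outside [U_v] is at least as close to another
    representative, which is more than [4 * dav v] from [v], so the facility is more than
    [2 * dav v] from [v]. At most half of the unit demand of [v] can go there. *)
Lemma U_y_ge_half Rs near : basic_LP_feasible I x y ->
  is_representatives I x Rs -> is_closest_rep I Rs near ->
  {in Rs, forall v, 1 / 2 <= x_set x (U I near [set v]) [set v] /\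
                    1 / 2 <= y_set y (U I near [set v])}.
Proof.
move=> [_ x1 xy _ [x01 y01]] rep cl v vRs.
have [RsC cov pw] := representativesP rep.
have vC : v \in C := fintype.subsetP RsC _ vRs.
suff H : 1 / 2 <= x_set x (U I near [set v]) [set v].
  split=> //; apply: (le_trans H); apply: ler_sum => i.
  by rewrite !inE => /andP[iF _]; rewrite big_set1 xy.
rewrite /x_set; under eq_bigr do rewrite big_set1.
have davE : dav v = \sum_(i in F) x i v * d i v by [].
have dav0 : 0 <= dav v.
  rewrite davE sumr_ge0 // => i iF; rewrite mulr_ge0 //.
    by have /andP[] := x01 _ _ iF vC.
  by apply: dist_ge0; rewrite inE ?iF ?vC ?orbT.
have far i : i \in F -> i \notin U I near [set v] -> 2 * dav v < d i v.
  move=> iF; rewrite !inE iF /= => nv.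
  have [nR /(_ _ vRs) le] := cl _ iF.
  have nC := fintype.subsetP RsC _ nR.
  have := pw _ _ vRs nR; rewrite eq_sym => /(_ nv).
  have := @dist_triangle _ _ I v i (near i); rewrite !inE iF vC nC !orbT.
  move=> /(_ isT isT isT); rewrite (@dist_sym _ _ I v i) ?inE ?iF ?vC ?orbT //.
  by move: le; lra.
have split1 := x1 _ vC; rewrite (bigID (mem (U I near [set v]))) /= in split1.
have E : \sum_(i in F | i \in U I near [set v]) x i v =
         \sum_(i in U I near [set v]) x i v.
  by apply: eq_bigl => i; rewrite !inE; case: (i \in F).
rewrite E in split1.
set out := \sum_(i in F | _) _ in split1.
suff : out <= 1 / 2 by move: split1; lra.
have out_le : 2 * dav v * out <= dav v.
  rewrite {2}davE (bigID (mem (U I near [set v]))) /= mulr_sumr.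
  rewrite -[X in X <= _]add0r lerD //.
    rewrite sumr_ge0 // => i /andP[iF _]; rewrite mulr_ge0 //.
      by have /andP[] := x01 _ _ iF vC.
    by apply: dist_ge0; rewrite inE ?iF ?vC ?orbT.
  apply: ler_sum => i /andP[iF /(far _ iF) dlt].
  by rewrite [leLHS]mulrC ler_wpM2l ?(ltW dlt) //; have /andP[] := x01 _ _ iF vC.
have out0 : 0 <= out.
  by apply: sumr_ge0 => i /andP[iF _]; have /andP[] := x01 _ _ iF vC.
have [dav_gt0|dav_le0] := ltP 0 (dav v).
  by rewrite -(ler_pM2l dav_gt0); move: out_le; lra.
(* If [dav v = 0], Markov's inequality says nothing; but then every term of [dav v] vanishes, while
   the facilities counted in [out] are at positive distance. *)
suff -> : out = 0 by lra.
have dav_eq0 : dav v = 0 by lra.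
apply: big1 => i /andP[iF /(far _ iF)]; rewrite dav_eq0 mulr0 => di.
have : \sum_(i in F) x i v * d i v = 0 by rewrite -davE.
move/eqP; rewrite psumr_eq0; last first.
  move=> k kF; rewrite mulr_ge0 //; first by have /andP[] := x01 _ _ kF vC.
  by apply: dist_ge0; rewrite inE ?kF ?vC ?orbT.
move/allP/(_ i); rewrite mem_index_enum iF => /(_ isT) /=.
by rewrite mulf_eq0 (gt_eqF di) orbF => /eqP.
Qed.

End Representatives.

(** * Size and diameter of black components *)

Section Kruskal.

Variables (R : realType) (T : finType) (I : instance R T) (y : T -> R).
Variables (l : nat) (near : T -> T) (Rs : {set T}).
Hypothesis RsC : Rs \subset clients I.
Hypothesis y_ge0 : {in facilities I, forall i, 0 <= y i}.

Local Notation d := (dist I).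

Definition edge_in (black : seq (T * T)) : rel T :=
  fun v w => ((v, w) \in black) || ((w, v) \in black).

Lemma edge_in_sym black : symmetric (edge_in black).
Proof. by move=> v w; rewrite /edge_in orbC. Qed.

Lemma y_set_U_mono (V W : {set T}) : V \subset W ->
  y_set y (U I near V) <= y_set y (U I near W).
Proof.
move=> VW; rewrite /y_set [leRHS](big_setID (U I near V)) /=.
have -> : U I near W :&: U I near V = U I near V.
  by apply/setIidPr/fintype.subsetP => i; rewrite !inE => /andP[-> /(fintype.subsetP VW)->].
by rewrite lerDl sumr_ge0 // => i; rewrite !inE => /and3P[_ iF _]; apply: y_ge0.
Qed.

Lemma y_set_UU (V W : {set T}) :
  y_set y (U I near (V :|: W)) <=
  y_set y (U I near V) + y_set y (U I near W).
Proof.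
rewrite /y_set (big_setID (U I near V)) /=.
have -> : U I near (V :|: W) :&: U I near V = U I near V.
  by apply/setIidPr/fintype.subsetP => i; rewrite !inE => /andP[-> ->].
rewrite lerD2l [leRHS](big_setID (U I near V)) /=.
rewrite -[leLHS]add0r lerD //.
  by rewrite sumr_ge0 // => i; rewrite !inE => /andP[/andP[iF _] _]; apply: y_ge0.
rewrite le_eqVlt; apply/orP; left; apply/eqP; apply: eq_bigl => i.
by rewrite !inE; case: (i \in facilities I) => //=; case: (near i \in V).
Qed.

(* A black component that is not a whole part lies inside a big part, so no later
   black edge touches it: every black component was once a part, and was complete
   before any edge leaving it was examined. *)
Record kruskal_inv (dn : seq (T * T)) (P : {set {set T}})
    (black : seq (T * T)) : Prop := KruskalInv {
  kinv_part : partition P Rs;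
  kinv_Rs : {in dn, forall e, e.1 \in Rs /\ e.2 \in Rs};
  kinv_done : {in dn, forall e, pblock P e.1 = pblock P e.2};
  kinv_black : {subset black <= dn};
  kinv_small : {in P, forall V : {set T}, is_small I y l near V ->
     {in V &, forall v w, connect (edge_in black) v w}};
  kinv_y : {in Rs, forall v, forall w, w != v ->
     connect (edge_in black) v w ->
     y_set y (U I near [set w in Rs | connect (edge_in black) v w]) < 2 * l%:R};
  kinv_len : forall e a b, e \in black -> connect (edge_in black) e.1 a ->
     a \in Rs -> b \in Rs -> ~~ connect (edge_in black) a b ->
     d e.1 e.2 <= d a b }.

(** Examined edges have both ends in one part, so a pair leaving a part is unexamined and, by
    [next_ge], at least as long as [e], hence as every black edge so far. Small parts are kept
    black-connected so that a black merge makes [V :|: W] a single black component. *)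
Lemma kruskal_step_inv dn e P black :
  e.1 \in Rs -> e.2 \in Rs ->
  {in dn, forall e', d e'.1 e'.2 <= d e.1 e.2} ->
  {in Rs &, forall a b, a != b -> (a, b) \notin rcons dn e ->
     (b, a) \notin rcons dn e -> d e.1 e.2 <= d a b} ->
  kruskal_inv dn P black ->
  let st := kruskal_step I y l near (P, black) e in
  kruskal_inv (rcons dn e) st.1 st.2.
Proof.
move=> e1R e2R dn_le next_ge inv; rewrite /kruskal_step.
set V := pblock P e.1; set W := pblock P e.2.
have [partP RsP doneP blackP smallP yP lenP] := inv.
have /and3P[/eqP coverP trivP set0P] := partP.
have [eqVW|neqVW] := eqVneq V W => /=.
  split=> //.
  - by move=> e'; rewrite mem_rcons inE => /predU1P[->//|/RsP].
  - by move=> e'; rewrite mem_rcons inE => /predU1P[->//|/doneP].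
  - by move=> e' /blackP; rewrite mem_rcons inE orbC => ->.
have VP : V \in P by rewrite pblock_mem // coverP.
have WP : W \in P by rewrite pblock_mem // coverP.
have e1V : e.1 \in V by rewrite mem_pblock coverP.
have e2W : e.2 \in W by rewrite mem_pblock coverP.
set P' := _ |: _.
have P'E A : A \in P' = (A == V :|: W) || [&& A != V, A != W & A \in P].
  by rewrite !inE negb_or -andbA.
have part' : partition P' Rs.
  apply/and3P; split.
  - rewrite -coverP /cover bigcup_setU big_set1.
    apply/eqP; apply/setP => a; rewrite inE.
    apply/idP/bigcupP => [/orP[|/bigcupP[A]]|[A AP aA]].
    + by rewrite inE => /orP[aV|aW]; [exists V | exists W].
    + by rewrite !inE => /andP[_ AP] aA; exists A.
    + have [AV|AV] := eqVneq A V; first by rewrite inE -AV aA.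
      have [AW|AW] := eqVneq A W; first by rewrite inE -AW aA orbT.
      by apply/orP; right; apply/bigcupP; exists A; rewrite ?inE ?(negPf AV) ?(negPf AW).
  - have dj A : A \in P -> A != V -> A != W -> [disjoint A & V :|: W].
      move=> AP AV AW; rewrite -setI_eq0 setIUr setU_eq0 !setI_eq0.
      by move/trivIsetP: trivP => tP; rewrite !tP.
    apply/trivIsetP => A A'; rewrite !P'E.
    move=> /predU1P[->|/and3P[AV AW AP]] /predU1P[->|/and3P[AV' AW' AP']].
    + by rewrite eqxx.
    + by rewrite disjoint_sym dj.
    + by rewrite dj.
    + by move/trivIsetP: trivP; apply.
  - rewrite P'E negb_or (negPf set0P) !andbF andbT.
    by apply/eqP => /setP/(_ e.1); rewrite !inE e1V.
have triv' : trivIset P' by have /and3P[] := part'.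
have blkVW a : a \in V :|: W -> pblock P' a = V :|: W.
  by move=> aVW; apply: def_pblock => //; rewrite P'E eqxx.
have blkO a : a \in Rs -> a \notin V :|: W -> pblock P' a = pblock P a.
  move=> aR aVW; apply: def_pblock; rewrite ?mem_pblock ?coverP // P'E.
  rewrite pblock_mem ?coverP // andbT; apply/orP; right.
  by apply/andP; split; apply: contraNneq aVW => <-; rewrite inE mem_pblock coverP aR ?orbT.
have inV a : a \in Rs -> (a \in V) = (pblock P a == V).
  by move=> aR; rewrite /V eq_sym eq_pblock ?coverP //.
have inW a : a \in Rs -> (a \in W) = (pblock P a == W).
  by move=> aR; rewrite /W eq_sym eq_pblock ?coverP //.
have done' : {in rcons dn e, forall e', pblock P' e'.1 = pblock P' e'.2}.
  move=> e'; rewrite mem_rcons inE => /predU1P[->|e'd].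
    by rewrite !blkVW // inE ?e1V ?e2W ?orbT.
  have [e'1 e'2] := RsP _ e'd; have same := doneP _ e'd.
  have same_mem : (e'.1 \in V :|: W) = (e'.2 \in V :|: W).
    by rewrite !inE !inV // !inW // same.
  have [in1|out1] := boolP (e'.1 \in V :|: W).
    by rewrite !blkVW // -same_mem.
  by rewrite !blkO // -same_mem.
have memVW c : c \in Rs -> (c \in V :|: W) = (pblock P' c == V :|: W).
  move=> cR; have [cVW|cVW] := boolP (c \in V :|: W); first by rewrite blkVW ?eqxx.
  apply/esym/negbTE; apply: contraNneq cVW => <-.
  by rewrite mem_pblock; have /and3P[/eqP-> _ _] := part'.
have Rs' : {in rcons dn e, forall e', e'.1 \in Rs /\ e'.2 \in Rs}.
  by move=> e'; rewrite mem_rcons inE => /predU1P[->//|/RsP].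
have big_mono (A A' : {set T}) : A \subset A' ->
    is_small I y l near A' -> is_small I y l near A.
  rewrite /is_small /is_big => sub; apply: contra => /le_trans; apply.
  exact: y_set_U_mono.
have [/andP[smV smW]|notsmall] := boolP (is_small I y l near V && is_small I y l near W);
  last first.
  split=> //.
  - by move=> e' /blackP; rewrite mem_rcons inE orbC => ->.
  - move=> A; rewrite P'E => /predU1P[->|/and3P[_ _ AP]]; last exact: smallP.
    (* A small union has small halves, so this merge would have been black. *)
    move=> sm; case/negP: notsmall.
    by apply/andP; split; apply: (big_mono _ (V :|: W)); rewrite ?subsetUl ?subsetUr.
set black' := e :: black.
have conn_mono a b : connect (edge_in black) a b -> connect (edge_in black') a b.
  apply: connect_sub => {}a {}b ab; apply: connect1.
  by case/orP: ab => ab; rewrite /edge_in !inE ab ?orbT.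
have ee : connect (edge_in black') e.1 e.2.
  by apply: connect1; rewrite /edge_in !inE -surjective_pairing eqxx.
have csym b : connect_sym (edge_in b) by apply: sym_connect_sym; apply: edge_in_sym.
have VWconn : {in V :|: W &, forall a b, connect (edge_in black') a b}.
  have toe1 a : a \in V :|: W -> connect (edge_in black') a e.1.
    rewrite inE => /orP[aV|aW]; first by apply/conn_mono/(smallP V).
    apply: (connect_trans (y := e.2)); last by rewrite csym.
    exact/conn_mono/(smallP W).
  by move=> a b aVW bVW; apply: connect_trans (toe1 a aVW) _; rewrite csym toe1.
have black'_sub : {subset black' <= rcons dn e}.
  move=> e'; rewrite mem_rcons !inE => /predU1P[->|/blackP->]; rewrite ?eqxx //.
  by rewrite orbT.
have closed_blk a b : edge_in black' a b -> (a \in V :|: W) = (b \in V :|: W).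
  move=> ab; have [aR bR] : a \in Rs /\ b \in Rs.
    by case/orP: ab => /black'_sub/Rs'[].
  have E : pblock P' a = pblock P' b.
    by case/orP: ab => /black'_sub/done' /=.
  by rewrite !memVW // E.
have conn_VW a b : connect (edge_in black') a b -> (a \in V :|: W) = (b \in V :|: W).
  exact: (closed_connect closed_blk).
(* The new edge lies inside [V :|: W], whose boundary no black edge crosses, so connectivity seen
   from outside is unchanged. *)
have conn_out a b : a \notin V :|: W ->
    connect (edge_in black') a b = connect (edge_in black) a b.
  move=> aO; apply/idP/idP; last exact: conn_mono.
  have cl : closed (edge_in black') [pred c | connect (edge_in black) a c].
    apply: (intro_closed (csym _)) => u w uw; rewrite !inE => au.
    have uO : u \notin V :|: W by rewrite -(conn_VW a) // conn_mono.
    apply: connect_trans au (connect1 _).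
    move: uw; rewrite /edge_in /black' !inE.
    have -> : ((u, w) == e) = false.
      by apply/eqP => eE; move: uO; rewrite inE -[u]/((u, w).1) eE e1V.
    have -> : ((w, u) == e) = false.
      by apply/eqP => eE; move: uO; rewrite !inE -[u]/((w, u).2) eE e2W orbT.
    by [].
  by move=> /(closed_connect cl); rewrite !inE connect0 => <-.
split=> //.
- move=> A; rewrite P'E => /predU1P[->|/and3P[_ _ AP]]; first by move=> _; apply: VWconn.
  by move=> sm a b aA bA; apply/conn_mono/(smallP A).
- move=> a aR b neq ab; have [aVW|aO] := boolP (a \in V :|: W).
    have -> : [set w in Rs | connect (edge_in black') a w] = V :|: W.
      apply/setP => c; rewrite inE; apply/andP/idP => [[_ /conn_VW <-//]|cVW].
      split; last exact: VWconn.
      rewrite -coverP; move: cVW; rewrite inE => /orP[cV|cW]; apply/bigcupP.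
        by exists V.
      by exists W.
    apply: le_lt_trans (y_set_UU _ _) _.
    move: smV smW; rewrite /is_small /is_big -!ltNge; lra.
  have -> : [set w in Rs | connect (edge_in black') a w] =
            [set w in Rs | connect (edge_in black) a w].
    by apply/setP => c; rewrite !inE conn_out.
  by apply: (yP _ aR b) => //; rewrite -conn_out.
- move=> e' a b e'b e'a aR bR ab.
  have [aVW|aO] := boolP (a \in V :|: W); last first.
    have e'O : e'.1 \notin V :|: W by rewrite (conn_VW _ a).
    apply: lenP => //; last by rewrite -conn_out.
      move: e'b; rewrite inE => /predU1P[eE|//].
      by move: e'O; rewrite eE inE e1V.
    by rewrite -conn_out.
  have bO : b \notin V :|: W by apply: contraNN ab => bVW; apply: VWconn.
  apply: (@le_trans _ _ (d e.1 e.2)).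
    by move: e'b; rewrite inE => /predU1P[->//|/blackP/dn_le].
  have nE c c' : (c \in V :|: W) != (c' \in V :|: W) -> (c, c') \notin rcons dn e.
    apply: contraNN => cc'; have [/= cR c'R] := Rs' _ cc'.
    by rewrite !memVW // (done' _ cc').
  apply: next_ge => //; first by apply: contraNneq bO => <-.
    by apply: nE; rewrite aVW (negPf bO).
  by apply: nE; rewrite aVW (negPf bO).
Qed.

Lemma kruskal_inv0 : kruskal_inv [::] [set [set v] | v in Rs] [::].
Proof.
have conn0 v w : connect (edge_in [::]) v w -> v = w.
  by case/connectP => -[|u p] //= _ ->.
split=> //.
- apply/and3P; split.
  + apply/eqP; apply/setP => v; apply/bigcupP/idP => [[A /imsetP[w wR ->]]|vR].
      by rewrite inE => /eqP->.
    by exists [set v]; rewrite ?set11 //; apply/imsetP; exists v.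
  + apply/trivIsetP => A A' /imsetP[v _ ->] /imsetP[w _ ->] neq.
    by rewrite disjoints1 inE; apply: contraNneq neq => ->.
  + by apply/imsetP => -[v _ /setP/(_ v)]; rewrite !inE eqxx.
- by move=> A /imsetP[u _ ->] _ v w; rewrite !inE => /eqP-> /eqP->.
- by move=> v vR w neq /conn0 vw; rewrite vw eqxx in neq.
Qed.

Lemma kruskal_invP es : is_edge_order I Rs es ->
  kruskal_inv es (kruskal I y l near Rs es).1 (kruskal I y l near Rs es).2.
Proof.
move=> [_ srt esRs esall].
have tr : transitive (fun e e' : T * T => d e.1 e.2 <= d e'.1 e'.2).
  by move=> ? ? ? /le_trans; apply.
suff gen es2 : forall dn st, es = dn ++ es2 -> kruskal_inv dn st.1 st.2 ->
    kruskal_inv es (foldl (kruskal_step I y l near) st es2).1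
                   (foldl (kruskal_step I y l near) st es2).2.
  by apply: (gen es [::]) => //; apply: kruskal_inv0.
elim: es2 => [|e es2 IH] dn [P black] esE inv /=; first by rewrite esE cats0.
apply: (IH (rcons dn e)); first by rewrite cat_rcons.
move: srt; rewrite (sorted_pairwise tr) esE pairwise_cat pairwise_cons.
move=> /and3P[/allrelP dn_le _ /andP[/allP es2_ge _]].
have [|e1R e2R _] := esRs e; first by rewrite esE mem_cat mem_head orbT.
apply: kruskal_step_inv => //.
  by move=> e' e'd; apply: dn_le; rewrite ?mem_head.
move=> a b aR bR neq nab nba.
have FC c : c \in Rs -> c \in facilities I :|: clients I.
  by move=> cR; rewrite inE (fintype.subsetP RsC) ?orbT.
have split_es e' : (e' \in es) = (e' \in rcons dn e) || (e' \in es2).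
  by rewrite esE -cat_rcons mem_cat.
have := esall _ _ aR bR neq; rewrite !split_es (negPf nab) (negPf nba) /=.
case abE: ((a, b) \in es2); first by move=> _; apply: (es2_ge (a, b)).
move=> /= baE; rewrite (dist_sym (FC _ aR) (FC _ bR)).
exact: (es2_ge (b, a)).
Qed.

Lemma black_component_sub es J : J \in black_components I y l near Rs es ->
  J \subset Rs /\ J != set0.
Proof.
move=> /imsetP[v vR ->]; split.
  by apply/fintype.subsetP => w; rewrite inE => /andP[].
by apply/set0Pn; exists v; rewrite inE vR connect0.
Qed.

(** The black merge that completed such a component united two small parts, each of y-value below
    [l]. *)
Lemma black_component_y es J : is_edge_order I Rs es ->
  J \in black_components I y l near Rs es -> (1 < #|J|)%N ->
  y_set y (U I near J) < 2 * l%:R.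
Proof.
move=> /kruskal_invP inv /imsetP[v vR JE] /card_gt1P[a [b [aJ bJ ab]]].
have [w] : exists2 w, w \in J & w != v.
  by have [av|av] := eqVneq a v; [exists b; rewrite // -av eq_sym|exists a].
rewrite JE inE => /andP[_ vw] wv.
exact: (kinv_y inv vR wv vw).
Qed.

(** This is diam J <= |J| L(J), with an arbitrary edge leaving [J] in place of the shortest one: a
    simple black path in [J] has fewer than |J| edges, none longer than an edge that leaves [J]. *)
Lemma black_component_diam es J : is_edge_order I Rs es ->
  J \in black_components I y l near Rs es ->
  {in J & &, forall v w a, forall b, b \in Rs :\: J ->
     d v w <= #|J|%:R * d a b}.
Proof.
move=> /kruskal_invP inv /imsetP[r rR ->] {J} v w a.
set black := (kruskal I y l near Rs es).2.
rewrite -[black_edge _ _ _ _ _ _]/(edge_in black) in inv *.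
have csym : connect_sym (edge_in black) by apply/sym_connect_sym/edge_in_sym.
set J := finset _; move=> vJ wJ aJ b; rewrite in_setD => /andP[bJ bR].
have JR c : c \in J -> c \in Rs by rewrite inE => /andP[].
have Jr c : c \in J -> connect (edge_in black) r c by rewrite inE => /andP[].
have FC c : c \in Rs -> c \in facilities I :|: clients I.
  by move=> cR; rewrite inE (fintype.subsetP RsC) ?orbT.
have ab : ~~ connect (edge_in black) a b.
  by apply: contra bJ => ab; rewrite inE bR (connect_trans (Jr _ aJ)).
have : connect (edge_in black) v w by apply: connect_trans (Jr _ wJ); rewrite csym Jr.
case/connectP => p0 pth0 ->.
case/shortenP: pth0 => p pth uniq_p _.
have d0 : 0 <= d a b by apply: dist_ge0; apply: FC => //; apply: JR.
have edge_len u u' : u \in J -> edge_in black u u' -> u' \in J /\ d u u' <= d a b.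
  move=> uJ uu'.
  have u'R : u' \in Rs by case/orP: uu' => /(kinv_black inv)/(kinv_Rs inv)[].
  have ru' : connect (edge_in black) r u'.
    exact: connect_trans (Jr _ uJ) (connect1 uu').
  split; first by rewrite inE u'R.
  have ua : connect (edge_in black) u a by apply: connect_trans (Jr _ aJ); rewrite csym Jr.
  have u'a : connect (edge_in black) u' a by apply: connect_trans (Jr _ aJ); rewrite csym.
  case/orP: uu' => e; first by apply: (kinv_len inv e) => //=; apply: JR.
  rewrite (dist_sym (FC _ (JR _ uJ)) (FC _ u'R)).
  by apply: (kinv_len inv e) => //=; apply: JR.
have [pJ le] : {subset v :: p <= J} /\ d v (last v p) <= (size p)%:R * d a b.
  elim: p v vJ pth {uniq_p} => [|u p IH] v vJ /=.
    by rewrite mul0r dist_xx ?FC ?JR // => _; split=> // c; rewrite inE => /eqP->.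
  move=> /andP[vu pth]; have [uJ dvu] := edge_len _ _ vJ vu.
  have [sub le] := IH _ uJ pth; split.
    by move=> c; rewrite inE => /predU1P[->//|/sub].
  rewrite -natr1 mulrDl mul1r addrC.
  have lastJ : last u p \in J by apply: sub; apply: mem_last.
  have := dist_triangle (FC _ (JR _ vJ)) (FC _ (JR _ uJ)) (FC _ (JR _ lastJ)).
  by move=> /le_trans; apply; rewrite lerD.
apply: (le_trans le); rewrite ler_wpM2r // ler_nat.
have : (size (v :: p) <= #|J|)%N.
  by rewrite cardE; apply: uniq_leq_size => // c /pJ; rewrite mem_enum.
by move=> /= /ltnW.
Qed.

End Kruskal.

(** * Rounding a knapsack with a cardinality constraint *)

Section CardinalityKnapsack.

Variables (R : realType) (T : finType) (B : {set T}).
Implicit Types (y r c u b : T -> R).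

Definition fractional y : {set T} := [set i in B | 0 < y i < 1].

(** Move along [delta] until the first coordinate reaches 0 or 1. Only fractional coordinates move,
    so one is lost and none is gained; [step i] is the time at which coordinate [i] stops. *)
Lemma fractional_push y delta i0 :
  {in B, forall i, 0 <= y i <= 1} -> delta i0 != 0 ->
  (forall i, delta i != 0 -> i \in fractional y) ->
  exists2 t, 0 <= t &
    {in B, forall i, 0 <= y i + t * delta i <= 1} /\
    (#|fractional (fun i => y i + t * delta i)%R| < #|fractional y|)%N.
Proof.
move=> y01 di0 dfrac.
pose step i := if 0 < delta i then (1 - y i) / delta i else y i / - delta i.
pose i1 := [arg min_(i < i0 | delta i != 0) step i]%O.
have [di1 min1] : delta i1 != 0 /\ forall i, delta i != 0 -> step i1 <= step i.
  by rewrite /i1; case: arg_minP.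
have step_ge0 i : delta i != 0 -> 0 <= step i.
  move=> di; have := dfrac _ di; rewrite inE => /and3P[_ y0 y1].
  rewrite /step; case: ltP => dl; rewrite divr_ge0 //; last 1 first.
  - by rewrite oppr_ge0.
  - by rewrite subr_ge0 ltW.
  - exact: ltW.
  - exact: ltW.
have t0 := step_ge0 _ di1.
have bnd i : delta i != 0 -> 0 <= y i + step i1 * delta i <= 1.
  move=> di; have := min1 _ di; have := dfrac _ di; rewrite inE => /and3P[_ y0 y1].
  rewrite /step -/(step i1); case: ltP => dl.
    rewrite ler_pdivlMr // => le; apply/andP; split.
      by rewrite addr_ge0 ?mulr_ge0 // ltW.
    by move: le; lra.
  have dneg : delta i < 0 by rewrite lt_neqAle di.
  rewrite ler_pdivlMr ?oppr_gt0 // mulrN => le.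
  have : step i1 * delta i <= 0 by rewrite mulr_ge0_le0.
  by move: le y1; lra.
exists (step i1) => //; split.
  move=> i iB; have [di|di] := eqVneq (delta i) 0; last exact: bnd.
  by rewrite di mulr0 addr0 y01.
apply: proper_card; apply/properP; split.
  apply/fintype.subsetP => i; rewrite inE => /andP[iB].
  have [di|/dfrac//] := eqVneq (delta i) 0.
  by rewrite di mulr0 addr0 inE iB.
exists i1; first exact: dfrac.
rewrite inE /= /step; case: (ltP 0 (delta i1)) => dl.
  by rewrite mulfVK // [_ + (1 - _)]addrC subrK ltxx !andbF.
by rewrite invrN mulrN mulNr mulfVK // subrr ltxx andbF.
Qed.

(* Three fractional coordinates leave a direction that preserves both the sum
   and the r-weighted sum; its sign is chosen so that c does not increase. *)
Lemma fractional_decrease y r c :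
  {in B, forall i, 0 <= y i <= 1} -> (2 < #|fractional y|)%N ->
  exists y' : T -> R,
    [/\ {in B, forall i, 0 <= y' i <= 1},
        \sum_(i in B) y' i = \sum_(i in B) y i,
        \sum_(i in B) r i * y' i = \sum_(i in B) r i * y i,
        \sum_(i in B) c i * y' i <= \sum_(i in B) c i * y i &
        (#|fractional y'| < #|fractional y|)%N].
Proof.
move=> y01 /card_gt2P[i [j [k [[iF jF kF] [ij jk ki]]]]].
have inB h : h \in fractional y -> h \in B by rewrite inE => /andP[].
have [[iB jB] kB] := (inB _ iF, inB _ jF, inB _ kF).
have [di [dj [dk [d0 s0 rs0]]]] : exists di dj dk : R,
  [/\ (di != 0) || (dj != 0), di + dj + dk = 0 &
      r i * di + r j * dj + r k * dk = 0].
  have [rij|rij] := eqVneq (r i) (r j).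
    exists 1, (-1), 0; split; first by rewrite oner_eq0.
      by rewrite subrr add0r.
    by rewrite rij; ring.
  (* The cross product of (r i, r j, r k) with (1, 1, 1). It vanishes when the three weights agree,
     hence the separate case above. *)
  exists (r j - r k), (r k - r i), (r i - r j); split; [|ring|ring].
  by rewrite !subr_eq0 -negb_and; apply: contra rij => /andP[/eqP-> /eqP->].
pose delta0 h := if h == i then di else if h == j then dj else if h == k then dk else 0.
have sumd (g : T -> R) : \sum_(h in B) g h * delta0 h = g i * di + g j * dj + g k * dk.
  rewrite (bigD1 i) //= (bigD1 j) ?jB 1?eq_sym //= (bigD1 k) ?kB ?ki 1?eq_sym //=.
  rewrite big1 ?addr0; last first.
    move=> h /andP[/andP[/andP[_ hi] hj] hk].
    by rewrite /delta0 (negPf hi) (negPf hj) (negPf hk) mulr0.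
  rewrite /delta0 !eqxx (negPf ki) [k == j]eq_sym (negPf jk) [j == i]eq_sym (negPf ij).
  by rewrite !addrA.
pose sg : R := if 0 < \sum_(h in B) c h * delta0 h then -1 else 1.
pose delta h := sg * delta0 h.
have sg0 : sg != 0 by rewrite /sg; case: ifP; rewrite ?oppr_eq0 oner_eq0.
have sumd' (g : T -> R) t : \sum_(h in B) g h * (y h + t * delta h) =
    \sum_(h in B) g h * y h + t * sg * \sum_(h in B) g h * delta0 h.
  rewrite mulr_sumr -big_split /=; apply: eq_bigr => h _.
  by rewrite /delta; ring.
have [h0 dh0] : exists h0, delta h0 != 0.
  case/orP: d0 => d0; [exists i|exists j]; rewrite mulf_neq0 // /delta0 ?eqxx //.
  by rewrite [j == i]eq_sym (negPf ij).
have dfrac h : delta h != 0 -> h \in fractional y.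
  have [->//|hi] := eqVneq h i; have [->//|hj] := eqVneq h j; have [->//|hk] := eqVneq h k.
  by rewrite /delta /delta0 (negPf hi) (negPf hj) (negPf hk) mulr0 eqxx.
have [t t0 [bnd lt]] := fractional_push y01 dh0 dfrac.
exists (fun h => y h + t * delta h); split=> //.
- have := sumd' (fun=> 1) t; rewrite sumd !mul1r s0 mulr0 addr0.
  by under eq_bigr do rewrite mul1r; under [in RHS]eq_bigr do rewrite mul1r.
- by rewrite sumd' sumd rs0 mulr0 addr0.
- rewrite sumd' gerDl -mulrA mulr_ge0_le0 //.
  by rewrite /sg; case: ltP => cs; rewrite ?mulN1r ?oppr_le0 ?mul1r // ltW.
Qed.

Lemma nearly_integral y r c : {in B, forall i, 0 <= y i <= 1} ->
  exists y' : T -> R,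
    [/\ {in B, forall i, 0 <= y' i <= 1},
        \sum_(i in B) y' i = \sum_(i in B) y i,
        \sum_(i in B) r i * y' i = \sum_(i in B) r i * y i,
        \sum_(i in B) c i * y' i <= \sum_(i in B) c i * y i &
        (#|fractional y'| <= 2)%N].
Proof.
have [n] := ubnP #|fractional y|; elim: n y => // n IH y lt_n y01.
have [le2|gt2] := leqP #|fractional y| 2; first by exists y; split.
have [y1 [y101 s1 r1 c1 lt1]] := fractional_decrease r c y01 gt2.
have [|y2 [y201 s2 r2 c2 le2]] := IH y1 _ y101.
  by apply: leq_trans lt1 _.
by exists y2; split=> //; rewrite ?s2 ?r2 // (le_trans c2).
Qed.

(** Moving the load of [o] to [w] adds at most [b o * c w] to the cost, and [b o <= l * b w] charges
    this to what [w] already pays. The factor [1 + l] does not depend on how far apart the two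
    facilities are. *)
Lemma merge_load (S : {set T}) b c (l : R) o w :
  S \subset B -> o \in B -> w \in B -> o != w -> o \notin S -> w \notin S ->
  {in B, forall i, 0 <= b i} -> {in B, forall i, 0 <= c i} -> 0 <= l ->
  {in B, forall i, i \notin [set o; w] -> i \notin S -> b i = 0} ->
  b o <= l * b w ->
  exists b' : T -> R,
    [/\ {in B, forall i, 0 <= b' i},
        {in B, forall i, i \notin w |: S -> b' i = 0},
        {in S, forall i, b' i = b i}, b' w = b o + b w &
        \sum_(i in B) b' i = \sum_(i in B) b i /\
        \sum_(i in B) b' i * c i <= (1 + l) * \sum_(i in B) b i * c i].
Proof.
move=> SB oB wB ow oS wS b0 c0 l0 bS bow.
pose b' i := if i == w then b o + b w else if i == o then 0 else b i.
have sumE (g : T -> R) : \sum_(i in B) b' i * g i =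
    \sum_(i in B) b i * g i + b o * (g w - g o).
  rewrite (bigD1 o) //= (bigD1 w) ?wB 1?eq_sym //= [in RHS](bigD1 o) //=.
  rewrite [in RHS](bigD1 w) ?wB 1?eq_sym //=.
  rewrite /b' eqxx (negPf ow) eqxx.
  under eq_bigr => i /andP[/andP[_ /negPf->] /negPf->] do [].
  by ring.
exists b'; split.
- move=> i iB; rewrite /b'; case: ifP => _; first by rewrite addr_ge0 ?b0.
  by case: ifP => _; rewrite ?b0.
- move=> i iB; rewrite !inE negb_or /b' => /andP[/negPf iw iS]; rewrite iw.
  by case: ifPn => // io; rewrite bS // !inE negb_or io iw.
- move=> i iS; rewrite /b'.
  have -> : (i == w) = false by apply: contraNF wS => /eqP<-.
  by have -> : (i == o) = false by apply: contraNF oS => /eqP<-.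
- by rewrite /b' eqxx.
split.
  have := sumE (fun=> 1); rewrite subrr mulr0 addr0.
  by under eq_bigr do rewrite mulr1; under [in RHS]eq_bigr do rewrite mulr1.
rewrite sumE mulrDl mul1r lerD2l.
apply: (@le_trans _ _ (l * (b w * c w))).
  have : b o * c w <= l * b w * c w by rewrite ler_wpM2r ?c0.
  have : 0 <= b o * c o by rewrite mulr_ge0 ?b0 ?c0.
  by rewrite mulrBr mulrA; lra.
rewrite ler_wpM2l // (bigD1 w) //= lerDl sumr_ge0 // => i /andP[iB _].
by rewrite mulr_ge0 ?b0 ?c0.
Qed.

(** Writing [b i = r i * y i] makes the total load and the cost linear in [y]: the exchanges then
    preserve the load, do not raise the cost, and keep each load below [u i * y' i]. *)
Lemma knapsack_round (N : nat) y b u c (l : R) :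
  1 <= l -> {in B, forall i, 0 <= y i <= 1} ->
  {in B, forall i, 0 <= b i <= u i * y i} ->
  {in B, forall i, 0 <= u i} -> {in B, forall i, 0 <= c i} ->
  \sum_(i in B) y i = N%:R ->
  exists (S : {set T}) (b' : T -> R),
    [/\ S \subset B, #|S| = N,
        {in B, forall i, 0 <= b' i} /\ {in B, forall i, i \notin S -> b' i = 0},
        {in S, forall i, b' i <= (1 + l^-1) * u i} &
        \sum_(i in B) b' i = \sum_(i in B) b i /\
        \sum_(i in B) b' i * c i <= (1 + l) * \sum_(i in B) b i * c i].
Proof.
move=> l1 y01 bu u0 c0 yN.
have l0 : 0 < l by lra.
have li0 : 0 < l^-1 by rewrite invr_gt0.
(* Where [y i = 0] the load is 0 as well, and division by zero returns the value 0 that is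
   wanted. *)
pose r i := b i / y i.
have rE i : i \in B -> r i * y i = b i.
  move=> iB; have [y0|y0] := eqVneq (y i) 0; last by rewrite /r mulfVK.
  have := bu _ iB; rewrite y0 !mulr0 => bb; lra.
have r0 i : i \in B -> 0 <= r i.
  move=> iB; have /andP[? _] := bu _ iB; have /andP[? _] := y01 _ iB.
  by rewrite divr_ge0.
have ru i : i \in B -> r i <= u i.
  move=> iB; have /andP[y0 _] := y01 _ iB; have [ye|yn] := eqVneq (y i) 0.
    by rewrite /r ye invr0 mulr0 u0.
  by rewrite ler_pdivrMr ?lt_neqAle 1?eq_sym ?yn //; have /andP[] := bu _ iB.
have [y' [y'01 sE rsE cE le2]] := nearly_integral r (fun i => r i * c i) y01.
pose b1 i := r i * y' i.
have b10 : {in B, forall i, 0 <= b1 i}.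
  by move=> i iB; rewrite mulr_ge0 ?r0 //; have /andP[] := y'01 _ iB.
have b1u : {in B, forall i, b1 i <= u i * y' i}.
  by move=> i iB; rewrite ler_wpM2r ?ru //; have /andP[] := y'01 _ iB.
have sb1 : \sum_(i in B) b1 i = \sum_(i in B) b i.
  by rewrite rsE; apply: eq_bigr => i /rE.
have cb1 : \sum_(i in B) b1 i * c i <= \sum_(i in B) b i * c i.
  have -> : \sum_(i in B) b i * c i = \sum_(i in B) r i * c i * y i.
    by apply: eq_bigr => i iB; rewrite mulrAC rE.
  apply: le_trans cE; rewrite le_eqVlt; apply/orP; left.
  by apply/eqP/eq_bigr => i _; rewrite mulrAC.
have cb1l : (1 + l) * \sum_(i in B) b1 i * c i <= (1 + l) * \sum_(i in B) b i * c i.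
  by rewrite ler_wpM2l //; lra.
pose S1 := [set i in B | y' i == 1].
have S1B : S1 \subset B by apply/fintype.subsetP => i; rewrite inE => /andP[].
have yE i : i \in B -> i \notin S1 -> i \notin fractional y' -> y' i = 0.
  move=> iB; rewrite !inE iB /= negb_and -!leNgt => n1 /orP[]; have /andP[h0 h1] := y'01 _ iB.
    by move=> h; apply/eqP; rewrite eq_le h h0.
  by move=> h; case/eqP: n1; apply/eqP; rewrite eq_le h h1.
have NE : N%:R = #|S1|%:R + \sum_(i in fractional y') y' i.
  rewrite -yN -sE (bigID (mem S1)) /=; congr (_ + _).
    rewrite (eq_bigr (fun=> 1)); last by move=> i /andP[_]; rewrite inE => /andP[_ /eqP].
    rewrite sumr_const; congr (1 *+ _); apply: eq_card => i; rewrite !inE.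
    by rewrite unfold_in /= inE andbA andbb.
  rewrite (bigID (mem (fractional y'))) /= [X in _ + X]big1 ?addr0; last first.
    by move=> i /andP[/andP[iB iS] iF]; apply: yE.
  apply: eq_bigl => i; rewrite !inE; case: (i \in B) => //=.
  by case: eqP => [->|_]; rewrite ?ltxx ?andbF.
have [F0|[a aF]] := set_0Vmem (fractional y').
  exists S1, b1; split=> //.
  - by move: NE; rewrite F0 big_set0 addr0 => /eqP; rewrite eqr_nat => /eqP.
  - by split=> // i iB iS; rewrite /b1 yE ?mulr0 // F0 inE.
  - move=> i iS; have iB := fintype.subsetP S1B _ iS.
    move: iS; rewrite inE => /andP[_ /eqP yi].
    have := b1u _ iB; rewrite yi mulr1 => /le_trans; apply.
    by rewrite ler_peMl ?u0 //; lra.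
  split=> //; apply: le_trans cb1l.
  rewrite ler_peMl ?sumr_ge0 //; last by lra.
  by move=> i iB; rewrite mulr_ge0 ?b10 ?c0.
have fB i : i \in fractional y' -> [/\ i \in B, 0 < y' i & y' i < 1].
  by rewrite inE => /and3P[].
have [aB a0 a1] := fB _ aF.
have [E|[a' a'F]] := set_0Vmem (fractional y' :\ a).
  (* A single fractional opening would put the integer [N] strictly between [#|S1|] and
     [#|S1| + 1]. *)
  have FE : fractional y' = [set a] by rewrite -(setD1K aF) E setU0.
  move: NE; rewrite FE big_set1 => NE; exfalso.
  have := ltr_nat R N #|S1|.+1; have := ltr_nat R #|S1| N.
  rewrite NE -natr1 ltrDl ltrD2l a0 a1 => /esym lt1 /esym; rewrite ltnS leqNgt lt1.
  by [].
have [neq a'F'] : a' != a /\ a' \in fractional y' by move: a'F; rewrite in_setD1 => /andP[].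
have [a'B a'0 a'1] := fB _ a'F'.
have FE : fractional y' = [set a'; a].
  apply/esym/eqP; rewrite eqEcard cards2 neq le2 andbT.
  by apply/fintype.subsetP => i /set2P[] ->.
have {}NE : N%:R = #|S1|%:R + (y' a' + y' a) by rewrite NE FE big_setU1 ?inE //= big_set1.
have NS : N = #|S1|.+1.
  have lt1 : (#|S1| < N)%N by rewrite -(ltr_nat R) NE; lra.
  have lt2 : (N < #|S1|.+2)%N by rewrite -(ltr_nat R) NE -!natr1; lra.
  by apply/eqP; rewrite eqn_leq -ltnS lt2 lt1.
have y1 : y' a' + y' a = 1 by move: NE; rewrite NS -natr1; lra.
have fS i : i \in fractional y' -> i \notin S1.
  by move=> /fB[_ _ lt]; rewrite inE negb_and (lt_eqF lt) orbT.
have finish o w : o \in fractional y' -> w \in fractional y' -> o != w ->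
    b1 o <= l * b1 w -> b1 o + b1 w <= (1 + l^-1) * u w ->
  exists (S : {set T}) (b' : T -> R),
    [/\ S \subset B, #|S| = N,
        {in B, forall i, 0 <= b' i} /\ {in B, forall i, i \notin S -> b' i = 0},
        {in S, forall i, b' i <= (1 + l^-1) * u i} &
        \sum_(i in B) b' i = \sum_(i in B) b i /\
        \sum_(i in B) b' i * c i <= (1 + l) * \sum_(i in B) b i * c i].
  move=> oF wF ow le le'.
  have [oB _ _] := fB _ oF; have [wB _ _] := fB _ wF.
  have FE' : fractional y' = [set o; w].
    apply/esym/eqP; rewrite eqEcard cards2 ow le2 andbT.
    by apply/fintype.subsetP => i /set2P[] ->.
  have [|b2 [b20 b2S b2E b2w [sb2 cb2]]] :=
    merge_load S1B oB wB ow (fS _ oF) (fS _ wF) b10 c0 (ltW l0) _ le.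
    by move=> i iB; rewrite -FE' => iF iS; rewrite /b1 yE ?mulr0.
  exists (w |: S1), b2; split=> //.
  - by apply/fintype.subsetP => i; rewrite inE => /orP[/set1P->|/(fintype.subsetP S1B)].
  - by rewrite cardsU1 fS.
  - move=> i; rewrite inE => /orP[/set1P->|iS]; first by rewrite b2w.
    rewrite b2E //; have iB := fintype.subsetP S1B _ iS.
    move: iS; rewrite inE => /andP[_ /eqP yi].
    have := b1u _ iB; rewrite yi mulr1 => /le_trans; apply.
    by rewrite ler_peMl ?u0 //; lra.
  by split; rewrite ?sb2 // (le_trans cb2).
(* Since the openings sum to 1, the merged load is at most a convex combination of the two
   capacities. *)
have small_into_big o w : o \in fractional y' -> w \in fractional y' -> o != w ->
    y' o + y' w = 1 -> u o <= u w -> b1 o + b1 w <= (1 + l^-1) * u w.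
  move=> /fB[oB oy _] /fB[wB wy _] ow s1 uu.
  apply: (@le_trans _ _ (u w)); last by rewrite ler_peMl ?u0 //; lra.
  have := b1u _ oB; have := b1u _ wB.
  have : u o * y' o <= u w * y' o by rewrite ler_wpM2r // ltW.
  have -> : y' w = 1 - y' o by lra.
  by rewrite mulrBr mulr1; lra.
have big_into_small o w : o \in fractional y' -> w \in fractional y' ->
    l * b1 o < b1 w -> b1 o <= l * b1 w /\ b1 o + b1 w <= (1 + l^-1) * u w.
  move=> /fB[oB oy _] /fB[wB wy w1] lt.
  have o_ge := b10 _ oB; have w_ge := b10 _ wB.
  have le1 : b1 o <= l * b1 o by rewrite ler_peMl.
  have le2' : b1 w <= l * b1 w by rewrite ler_peMl.
  split; first by lra.
  have : b1 o <= l^-1 * b1 w by rewrite mulrC ler_pdivlMr // mulrC ltW.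
  have bw : b1 w <= u w.
    by apply: (le_trans (b1u _ wB)); rewrite ler_piMr ?u0 // ltW.
  have : l^-1 * b1 w <= l^-1 * u w by rewrite ler_wpM2l // ltW.
  by rewrite mulrDl mul1r; lra.
(* Merging into the larger capacity never overloads; it is too expensive only when
   the larger facility carries less than a fraction 1/l of the load of the other,
   and then the smaller one absorbs it within a factor 1 + 1/l. *)
have pick o w : o \in fractional y' -> w \in fractional y' -> o != w ->
    y' o + y' w = 1 -> u o <= u w ->
    exists o' w', [/\ o' \in fractional y', w' \in fractional y', o' != w',
                     b1 o' <= l * b1 w' & b1 o' + b1 w' <= (1 + l^-1) * u w'].
  move=> oF wF ow s1 uu; have [le|lt] := leP (b1 o) (l * b1 w).
    by exists o, w; split=> //; apply: small_into_big.
  by exists w, o; have [? ?] := big_into_small _ _ wF oF lt; split=> //; rewrite eq_sym.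
have [le|/ltW le] := leP (u a') (u a).
  by have [o [w [? ? ? ? ?]]] := pick _ _ a'F' aF neq y1 le; apply: (finish o w).
rewrite eq_sym in neq; rewrite addrC in y1.
by have [o [w [? ? ? ? ?]]] := pick _ _ aF a'F' neq y1 le; apply: (finish o w).
Qed.

End CardinalityKnapsack.

(** * Local solutions *)

(** Here [k a] already carries the weight [z a]; the conclusion bounds [k a / z a] with denominators
    cleared. Among the indices with [N a <= n], the cheapest costs no more than their average. *)
Lemma markov_choice (R : realType) (A : finType) (W : {set A}) (z k : A -> R)
    (N : A -> nat) (s K : R) (n : nat) :
  {in W, forall a, 0 <= z a} -> {in W, forall a, 0 <= k a} ->
  0 < \sum_(a in W) z a -> s < n.+1%:R ->
  \sum_(a in W) z a * (N a)%:R <= (\sum_(a in W) z a) * s ->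
  \sum_(a in W) k a <= K ->
  exists a, [/\ a \in W, 0 < z a, (N a <= n)%N &
    (\sum_(a in W) z a) * (n.+1%:R - s) * k a <= n.+1%:R * K * z a].
Proof.
set g := \sum_(a in W) z a => z0 k0 g0 sn zN kK.
have n0 : 0 < n.+1%:R :> R by rewrite ltr0n.
have sn0 : 0 < n.+1%:R - s by rewrite subr_gt0.
have K0 : 0 <= K by apply: le_trans kK; apply: sumr_ge0.
pose W' := [set a in W | (N a <= n)%N].
have W'W (h : A -> R) : \sum_(a in W) h a =
    \sum_(a in W') h a + \sum_(a in W | ~~ (N a <= n)%N) h a.
  rewrite (bigID (fun a => (N a <= n)%N)) /=; congr (_ + _).
  by apply: eq_bigl => a; rewrite inE.
have w'_ge : g * (n.+1%:R - s) <= n.+1%:R * \sum_(a in W') z a.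
  (* [N a] is an integer, so exceeding [n] means reaching [n.+1]; this is what admits every
     [s < n.+1]. *)
  have : n.+1%:R * \sum_(a in W | ~~ (N a <= n)%N) z a <= g * s.
    apply: le_trans zN; rewrite (W'W (fun a => z a * (N a)%:R)) mulr_sumr.
    rewrite -[leLHS]add0r lerD //.
      by apply: sumr_ge0 => a; rewrite inE => /andP[aW _]; rewrite mulr_ge0 ?z0.
    apply: ler_sum => a /andP[aW Na]; rewrite mulrC ler_wpM2l ?z0 // ler_nat.
    by rewrite ltnNge.
  by rewrite /g (W'W z); lra.
apply: contrapT => none.
have gt a : a \in W' -> 0 < z a -> 0 < g * (n.+1%:R - s) * k a - n.+1%:R * K * z a.
  rewrite inE => /andP[aW Na] za; rewrite subr_gt0 ltNge; apply/negP => le.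
  by apply: none; exists a; split.
have [a0 a0W' za0] : exists2 a, a \in W' & 0 < z a.
  apply: contrapT => no; have : \sum_(a in W') z a = 0.
    apply: big1 => a aW'; apply/eqP; rewrite eq_le leNgt.
    have := aW'; rewrite inE => /andP[aW _]; rewrite z0 // andbT.
    by apply/negP => za; apply: no; exists a.
  move=> w'0; move: w'_ge; rewrite w'0 mulr0 leNgt => /negP; apply.
  by rewrite mulr_gt0.
have : 0 < \sum_(a in W') (g * (n.+1%:R - s) * k a - n.+1%:R * K * z a).
  rewrite (bigD1 a0) //= ltr_pwDl ?gt // sumr_ge0 // => a /andP[aW' _].
  have := aW'; rewrite inE => /andP[aW _].
  have [za|za] := ltP 0 (z a); first by rewrite ltW ?gt.
  have -> : z a = 0 by apply/eqP; rewrite eq_le za z0.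
  by rewrite mulr0 subr0 mulr_ge0 ?k0 // mulr_ge0 // ltW.
rewrite sumrB -!mulr_sumr subr_gt0 ltNge => /negP; apply.
have kW' : \sum_(a in W') k a <= K.
  apply: le_trans kK; rewrite (W'W k) lerDl; apply: sumr_ge0 => a /andP[aW _].
  exact: k0.
apply: (@le_trans _ _ (g * (n.+1%:R - s) * K)).
  by rewrite ler_wpM2l // mulr_ge0 // ltW.
by rewrite [leRHS]mulrAC ler_wpM2r.
Qed.

Section TwoPointDistribution.

Variables (R : realType) (A : choiceType).

Lemma two_point_distribution (p0 p1 : A) (t : R) : 0 <= t <= 1 ->
  exists phi : {fsfun A -> R with 0},
    [/\ is_distribution phi,
        forall a, a \in finsupp phi -> a = p0 \/ a = p1,
        (#|` finsupp phi| <= 2)%N &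
        forall g, expectation phi g = (1 - t) * g p0 + t * g p1].
Proof.
move=> /andP[t0 t1].
(* The contributions are added, so that [p0 = p1] receives mass 1. *)
pose h a : R := (if a == p0 then 1 - t else 0) + (if a == p1 then t else 0).
pose phi : {fsfun A -> R with 0} := [fsfun a in [fset p0; p1]%fset => h a].
have h_ge0 a : 0 <= h a.
  by rewrite addr_ge0 //; case: ifP => // _; rewrite subr_ge0.
have phiE a : phi a = h a.
  rewrite fsfunE in_fset2 /h; case: eqP => //= _; case: eqP => //= _.
  by rewrite addr0.
have sub : (finsupp phi `<=` [fset p0; p1])%fset by apply: finsupp_sub.
have expE g : expectation phi g = (1 - t) * g p0 + t * g p1.
  rewrite /expectation (big_fset_incl _ sub) /=; last first.
    by move=> a _; rewrite mem_finsupp negbK => /eqP->; rewrite mul0r.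
  under eq_bigr do rewrite phiE.
  have [eq01|neq] := eqVneq p0 p1.
    by rewrite -eq01 fsetUid big_seq_fset1 /h -eq01 eqxx; ring.
  rewrite big_fsetU1 ?in_fset1 //= big_seq_fset1 /h !eqxx [p1 == p0]eq_sym (negPf neq).
  by ring.
exists phi; split=> //.
- split=> [a|]; first by rewrite phiE.
  have := expE (fun=> 1); rewrite /expectation; under eq_bigr do rewrite mulr1.
  by move=> ->; ring.
- by move=> a /(fsubsetP sub); rewrite in_fset2 => /orP[]/eqP; [left|right].
- by apply: leq_trans (fsubset_leq_card sub) _; rewrite cardfs2; case: eqP.
Qed.

End TwoPointDistribution.

Lemma subset_extend (T : finType) (S B : {set T}) (n : nat) :
  S \subset B -> (#|S| <= n <= #|B|)%N ->
  exists S' : {set T}, [/\ S \subset S', S' \subset B & #|S'| = n].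
Proof.
move=> SB /andP[Sn nB]; pose r := take (n - #|S|) (enum (B :\: S)).
have ur : uniq r by rewrite take_uniq // enum_uniq.
have rE i : i \in r -> i \in B :\: S by move=> /mem_take; rewrite mem_enum.
have sr : size r = (n - #|S|)%N.
  by rewrite size_takel // -cardE cardsD (setIidPr SB) leq_sub2r.
exists (S :|: [set i in r]); split; first exact: subsetUl.
  apply/fintype.subsetP => i; rewrite !inE => /orP[/(fintype.subsetP SB)//|/rE].
  by rewrite inE => /andP[].
rewrite cardsU.
have -> : S :&: [set i in r] = set0.
  by apply/setP => i; rewrite !inE; apply/andP => -[iS /rE]; rewrite inE iS.
rewrite cards0 subn0.
have -> : #|[set i in r]| = size r.
  by rewrite -(card_uniqP ur); apply: eq_card => i; rewrite inE.
by rewrite sr subnKC.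
Qed.

(** * Building and mixing solutions for one component *)

Section LocalSolutions.

Variables (R : realType) (T : finType) (I : instance R T).
Variables (x : T -> T -> R) (y : T -> R) (Rs : {set T}) (near : T -> T).
Variables (J : {set T}).

Local Notation F := (facilities I).
Local Notation C := (clients I).
Local Notation d := (dist I).
Local Notation u := (capacity I).
Local Notation dav := (d_av I x).
Local Notation B := (U I near J).
Local Notation X := (x_set x B C).

Hypothesis LP : basic_LP_feasible I x y.
Hypothesis rep : is_representatives I x Rs.
Hypothesis closest : is_closest_rep I Rs near.
Hypothesis JRs : J \subset Rs.

Let x_ge0 i j : i \in F -> j \in C -> 0 <= x i j.
Proof. by case: LP => _ _ _ _ [x01 _] iF jC; have /andP[] := x01 _ _ iF jC. Qed.

Let x_sum1 j : j \in C -> \sum_(i in F) x i j = 1.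
Proof. by case: LP => _ x1 _ _ _; apply: x1. Qed.

Let BF i : i \in B -> i \in F.
Proof. by rewrite inE => /andP[]. Qed.

Let RsC v : v \in Rs -> v \in C.
Proof. by have [/fintype.subsetP sub _ _] := representativesP rep; apply: sub. Qed.

Let JC v : v \in J -> v \in C.
Proof. by move=> vJ; apply/RsC/(fintype.subsetP JRs). Qed.

Let nearJ i : i \in B -> near i \in J.
Proof. by rewrite inE => /andP[]. Qed.

Let FFC i : i \in F -> i \in F :|: C.
Proof. by move=> iF; rewrite inE iF. Qed.

Let CFC i : i \in C -> i \in F :|: C.
Proof. by move=> iF; rewrite inE iF orbT. Qed.

Lemma sum_U_partition (g : T -> R) :
  \sum_(i in B) g i = \sum_(v in J) \sum_(i in U I near [set v]) g i.
Proof.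
rewrite (partition_big near (mem J)) /=; last exact: nearJ.
apply: eq_bigr => v vJ; apply: eq_bigl => i; rewrite !inE.
by case: eqP => [->|]; rewrite ?vJ ?andbT ?andbF.
Qed.

Lemma x_set_alpha : X = \sum_(v in J) alpha I x near v.
Proof. exact: sum_U_partition. Qed.

Lemma EMD_le (a b : T -> R) (f : T -> T -> R) :
  is_transport I near J a b f ->
  EMD I near J a b <= \sum_(v in J) \sum_(i in B) f v i * d v i.
Proof.
move=> tr; apply: ge_inf; last by exists f.
exists 0 => _ [f' [f0 _ _] ->]; apply: sumr_ge0 => v vJ; apply: sumr_ge0 => i iB.
rewrite mulr_ge0 ?f0 //; apply: dist_ge0; first exact/CFC/JC.
exact/FFC/BF.
Qed.

(** [kappa] is the capacity violation and [c] a cost bound. Loads are finite functions on all of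
    [T], so that the pairs form a choice type, over which finitely supported distributions are
    defined. *)
Definition local_solution (kappa : R) (n : nat) (c : R)
    (p : {set T} * {ffun T -> R}) : Prop :=
  [/\ p.1 \subset B, #|p.1| = n,
      (forall i, 0 <= p.2 i) /\ (forall i, i \notin p.1 -> p.2 i = 0),
      {in p.1, forall i, p.2 i <= kappa * (u i)%:R} &
      \sum_(i in p.1) p.2 i = X /\
      EMD I near J (alpha I x near) p.2 <= c].

(** An atom may cost far more than [c] if its mass is small; hence the hypotheses bound mass times
    cost. Size [t.+1] is requested only when [s] is not an integer. *)
Lemma mix_local_solutions (kappa s c0 c1 c : R) (t : nat) :
  t%:R <= s < t.+1%:R ->
  (exists p0, local_solution kappa t c0 p0) ->
  (t%:R < s -> exists p1, local_solution kappa t.+1 c1 p1) ->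
  (t.+1%:R - s) * c0 <= c -> (s - t%:R) * c1 <= c -> 0 <= c ->
  exists phi : {fsfun ({set T} * {ffun T -> R})%type -> R with 0},
    [/\ is_distribution phi,
        forall p, p \in finsupp phi ->
          (exists n e, local_solution kappa n e p) /\
          (#|p.1|%:Z = Num.floor s \/ #|p.1|%:Z = Num.ceil s),
        expectation phi (fun p => #|p.1|%:R) = s,
        (#|` finsupp phi| <= 2)%N &
        expectation phi (fun p => EMD I near J (alpha I x near) p.2) <= c + c].
Proof.
move=> /andP[ts st] [p0 sol0] ex1 le0 le1 c_ge0.
have flE : Num.floor s = t%:Z.
  by apply: floor_def; rewrite intrD mulr1z -pmulrn natr1 ts.
have [_ card0 _ _ [_ emd0]] := sol0.
have [st0|ts_lt] := leP s t%:R.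
  have sE : s = t%:R by apply/eqP; rewrite eq_le st0 ts.
  have [phi [dphi supp card2 expE]] := @two_point_distribution R _ p0 p0 0 ltac:(lra).
  exists phi; split=> //.
  - move=> p /supp pE; have {pE}-> : p = p0 by case: pE.
    split; first by exists t, c0.
    by left; rewrite flE card0.
  - by rewrite expE card0 sE; ring.
  - rewrite expE; move: le0; rewrite sE -natr1.
    have -> : t%:R + 1 - t%:R = 1 :> R by ring.
    by move: emd0; lra.
have [p1 sol1] := ex1 ts_lt; have [_ card1 _ _ [_ emd1]] := sol1.
have cE : Num.ceil s = t.+1%:Z.
  by apply: ceil_def; rewrite intrB mulr1z -pmulrn -natr1 addrK ts_lt natr1 ltW.
have t01 : 0 <= s - t%:R <= 1 by move: st; rewrite -natr1; lra.
have [phi [dphi supp card2 expE]] := @two_point_distribution R _ p0 p1 _ t01.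
exists phi; split=> //.
- move=> p /supp [->|->].
    by split; [exists t, c0|left; rewrite flE card0].
  by split; [exists t.+1, c1|right; rewrite cE card1].
- by rewrite expE card0 card1 -natr1; ring.
- rewrite expE lerD //.
    apply: le_trans le0; rewrite -natr1.
    have -> : 1 - (s - t%:R) = t%:R + 1 - s by ring.
    by rewrite ler_wpM2l //; move: st; rewrite -natr1; lra.
  by apply: le_trans le1; rewrite ler_wpM2l //; lra.
Qed.

Let dav_ge0 j : j \in C -> 0 <= dav j.
Proof.
move=> jC; apply: sumr_ge0 => i iF; rewrite mulr_ge0 ?x_ge0 //.
by apply: dist_ge0; [exact: FFC|exact: CFC].
Qed.

Let d_ge0 i j : i \in F -> j \in C -> 0 <= d i j.
Proof. by move=> iF jC; apply: dist_ge0; [exact: FFC|exact: CFC]. Qed.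

Let near_le i j : i \in B -> j \in C -> d (near i) i <= d i j + 4 * dav j.
Proof.
move=> iB jC; rewrite dist_sym; last exact/FFC/BF; last exact/CFC/JC/nearJ.
by apply: (closest_rep_dist rep closest) => //; apply: BF.
Qed.

Let near_ge0 i : i \in B -> 0 <= d (near i) i.
Proof. by move=> iB; apply: dist_ge0; [apply/CFC/JC/nearJ|apply/FFC/BF]. Qed.

Definition client_share (j : T) : R := \sum_(i in B) x i j.
Local Notation a := client_share.

Lemma client_shareE j : x_set x B [set j] = a j.
Proof. by apply: eq_bigr => i _; rewrite big_set1. Qed.

Lemma client_share_compl j : j \in C -> 1 - a j = \sum_(i in F :\: B) x i j.
Proof.
move=> jC; rewrite -(x_sum1 jC) (big_setID B) /=.
have -> : F :&: B = B by apply/setIidPr/fintype.subsetP => i /BF.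
by rewrite -/(a j) addrAC subrr add0r.
Qed.

Lemma client_share_itv j : j \in C -> 0 <= a j <= 1.
Proof.
move=> jC; rewrite sumr_ge0 /=; last by move=> i /BF iF; rewrite x_ge0.
rewrite -subr_ge0 client_share_compl // sumr_ge0 // => i.
by rewrite inE => /andP[_ iF]; rewrite x_ge0.
Qed.

Lemma x_set_client_share : X = \sum_(j in C) a j.
Proof. by rewrite /x_set exchange_big. Qed.

Lemma pi_set_client_share :
  pi_set I x near J = \sum_(j in C) a j * (1 - a j).
Proof. by apply: eq_bigr => j _; rewrite client_shareE. Qed.

Lemma pi_set_ge0 : 0 <= pi_set I x near J.
Proof.
rewrite pi_set_client_share sumr_ge0 // => j /client_share_itv/andP[? ?].
by rewrite mulr_ge0 // subr_ge0.
Qed.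

Lemma D_set_ge0 : 0 <= D_set I x B.
Proof.
apply: sumr_ge0 => i /BF iF; apply: sumr_ge0 => j jC.
by rewrite mulr_ge0 ?x_ge0 // addr_ge0 ?d_ge0 ?dav_ge0.
Qed.

(** The price of bringing the demand held at representatives back to the clients it comes from:
    [x i j] units travel from [near i] through [i] to [j]. *)
Definition serve_cost : R :=
  \sum_(i in B) \sum_(j in C) x i j * (d i j + d (near i) i).

Lemma serve_cost_le : serve_cost <= 4 * D_set I x B.
Proof.
rewrite /serve_cost /D_set mulr_sumr; apply: ler_sum => i iB.
rewrite /D_of mulr_sumr; apply: ler_sum => j jC.
rewrite mulrCA ler_wpM2l ?x_ge0 ?BF //.
have := near_le iB jC; have := d_ge0 (BF iB) jC; lra.
Qed.

(* A client split between B and the outside connects J to Rs minus J through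
   two facilities, each close to its representative. *)
Lemma pi_set_sep (len : R) : 0 <= len ->
  {in J & Rs :\: J, forall v w, len <= d v w} ->
  pi_set I x near J * len <= 10 * D_set I x B.
Proof.
move=> len0 sep.
(* [a j * (1 - a j)] is the total weight of pairs of a facility in [B] and one outside, both serving
   [j]. *)
have -> : pi_set I x near J * len =
    \sum_(i in B) \sum_(j in C) \sum_(i' in F :\: B) x i j * (x i' j * len).
  rewrite pi_set_client_share exchange_big /= mulr_suml; apply: eq_bigr => j jC.
  rewrite client_share_compl // -mulrA mulr_suml; apply: eq_bigr => i _.
  by rewrite mulr_suml mulr_sumr.
rewrite /D_set mulr_sumr; apply: ler_sum => i iB.
rewrite /D_of mulr_sumr; apply: ler_sum => j jC.
have iF := BF iB.
rewrite -mulr_sumr mulrCA ler_wpM2l ?x_ge0 //.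
have bound i' : i' \in F :\: B -> len <= 2 * d i j + 2 * d i' j + 8 * dav j.
  rewrite inE => /andP[i'B i'F].
  have [nR _] := closest i'F.
  have nJ : near i' \notin J by move: i'B; rewrite inE i'F.
  have le := sep _ _ (nearJ iB) (_ : near i' \in Rs :\: J).
  have {}le : len <= d (near i) (near i') by apply: le; rewrite inE nJ nR.
  have h1 := near_le iB jC.
  have h2 := closest_rep_dist rep closest i'F jC.
  have FCn := CFC (JC (nearJ iB)); have FCn' := CFC (RsC nR).
  have t1 := dist_triangle FCn (FFC iF) FCn'.
  have t2 := dist_triangle (FFC iF) (CFC jC) FCn'.
  have t3 := dist_triangle (CFC jC) (FFC i'F) FCn'.
  rewrite (dist_sym (CFC jC) (FFC i'F)) in t3.
  by move: le h1 h2 t1 t2 t3; lra.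
apply: (@le_trans _ _ (\sum_(i' in F :\: B)
    (x i' j * (2 * d i j + 8 * dav j) + 2 * (x i' j * d i' j)))).
  apply: ler_sum => i' i'FB.
  have i'F : i' \in F by move: i'FB; rewrite inE => /andP[].
  by have := ler_wpM2l (x_ge0 i'F jC) (bound _ i'FB); lra.
rewrite big_split /= -mulr_suml -client_share_compl // -mulr_sumr.
(* Twice this [dav j], added to the [8 * dav j] of [bound], gives the constant 10. *)
have out_le : \sum_(i' in F :\: B) x i' j * d i' j <= dav j.
  rewrite /d_av [leRHS](big_setID B) /= lerDr sumr_ge0 // => i'.
  by rewrite inE => /andP[i'F _]; rewrite mulr_ge0 ?x_ge0 ?d_ge0.
have dij := d_ge0 iF jC; have dj := dav_ge0 jC.
have /andP[a0 _] := client_share_itv jC.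
have : (1 - a j) * (2 * d i j + 8 * dav j) <= 2 * d i j + 8 * dav j.
  by rewrite ler_piMl; lra.
by move: out_le dij dj; lra.
Qed.

(* Demand is routed through each client j by the product of the shares x i j and
   b i' j; the unrouted demand X - M is spread proportionally over the loads. *)
Lemma config_solution (S : {set T}) (b : T -> T -> R) (eps diam : R) :
  S \subset B -> 0 < X -> 0 <= eps <= 1 / 2 ->
  {in B & C, forall i j, 0 <= b i j} ->
  {in B & C, forall i j, i \notin S -> b i j = 0} ->
  {in C, forall j, \sum_(i in B) b i j <= 1} ->
  {in B, forall i, \sum_(j in C) b i j <= (u i)%:R} ->
  {in J &, forall v w, d v w <= diam} ->
  let M := \sum_(i in B) \sum_(j in C) a j * b i j in
  (1 - eps) * X <= M ->
  exists beta, local_solution (1 + 2 * eps) #|S|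
    (serve_cost + \sum_(i in B) \sum_(j in C) b i j * (d i j + d (near i) i)
     + (X - M) * diam) (S, beta).
Proof.
move=> SB X0 eps0 b0 bS b1 bu diamJ M MX.
pose m i := \sum_(j in C) a j * b i j.
have M0 : 0 < M.
  by apply: lt_le_trans MX; rewrite mulr_gt0 //; lra.
have a01 := client_share_itv.
have a0 j : j \in C -> 0 <= a j by move=> /a01/andP[].
have a1 j : j \in C -> a j <= 1 by move=> /a01/andP[].
have m0 i : i \in B -> 0 <= m i.
  by move=> iB; apply: sumr_ge0 => j jC; rewrite mulr_ge0 ?a0 ?b0.
have mb i : i \in B -> m i <= \sum_(j in C) b i j.
  by move=> iB; apply: ler_sum => j jC; rewrite ler_piMl ?a1 ?b0.
(* This is 1 / (1 - eps) <= 1 + 2 eps, valid for eps <= 1/2. *)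
have ratio : X / M <= 1 + 2 * eps.
  rewrite ler_pdivrMr //; apply: (@le_trans _ _ ((1 + 2 * eps) * ((1 - eps) * X))).
    rewrite mulrA ler_peMl ?(ltW X0) //.
    have -> : (1 + 2 * eps) * (1 - eps) = 1 + eps * (1 - 2 * eps) by ring.
    by rewrite lerDl mulr_ge0; lra.
  by rewrite ler_wpM2l //; lra.
have MX' : M <= X.
  rewrite x_set_client_share /M exchange_big /=; apply: ler_sum => j jC.
  by rewrite -mulr_sumr ler_piMr ?a0 ?b1.
(* Hence spreading the unrouted demand proportionally adds at most [m i] at each [i], which
   [second_part] uses. *)
have XM : X - M <= M.
  have : 1 / 2 * X <= (1 - eps) * X by rewrite ler_wpM2r ?(ltW X0) //; lra.
  by move: MX; lra.
pose beta : {ffun T -> R} := [ffun i => if i \in S then m i * (X / M) else 0].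
have mS i : i \in B -> i \notin S -> m i = 0.
  by move=> iB iS; apply: big1 => j jC; rewrite bS // mulr0.
have betaB i : i \in B -> beta i = m i * (X / M).
  by move=> iB; rewrite ffunE; case: ifPn => // /mS->; rewrite ?mul0r.
pose share v j := \sum_(i in U I near [set v]) x i j.
pose f1 v i := \sum_(j in C) share v j * b i j.
pose rest v := alpha I x near v - \sum_(i in B) f1 v i.
pose f v i := f1 v i + rest v * (m i / M).
have UvF v i : i \in U I near [set v] -> i \in F by rewrite inE => /andP[].
have share0 v j : j \in C -> 0 <= share v j.
  by move=> jC; apply: sumr_ge0 => i /UvF iF; rewrite x_ge0.
have f10 v i : i \in B -> 0 <= f1 v i.
  by move=> iB; apply: sumr_ge0 => j jC; rewrite mulr_ge0 ?share0 ?b0.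
have sum_share j : \sum_(v in J) share v j = a j.
  by rewrite /share -sum_U_partition.
have sum_f1 i : \sum_(v in J) f1 v i = m i.
  rewrite exchange_big /=; apply: eq_bigr => j _.
  by rewrite -mulr_suml sum_share.
have rest0 v : 0 <= rest v.
  rewrite subr_ge0 /alpha /x_set exchange_big /= [leRHS]exchange_big /=.
  apply: ler_sum => j jC; rewrite -mulr_sumr -[leRHS]/(share v j).
  by rewrite ler_piMr ?share0 ?b1.
have sum_rest : \sum_(v in J) rest v = X - M.
  rewrite sumrB -x_set_alpha exchange_big /=; congr (_ - _).
  by apply: eq_bigr => i _; rewrite sum_f1.
have MM : \sum_(i in B) m i / M = 1 by rewrite -mulr_suml mulfV // gt_eqF.
have tr : is_transport I near J (alpha I x near) beta f.
  split.
  - move=> v i vJ iB; rewrite addr_ge0 ?f10 // mulr_ge0 // divr_ge0 ?m0 //.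
    exact: ltW.
  - by move=> v vJ; rewrite big_split /= -mulr_sumr MM mulr1 addrC subrK.
  - move=> i iB; rewrite big_split /= sum_f1 -mulr_suml sum_rest betaB //.
    rewrite le_eqVlt; apply/orP; left; apply/eqP.
    by field; rewrite gt_eqF.
exists beta; split=> //=.
- split=> i; last by rewrite ffunE => /negPf->.
  rewrite ffunE; case: ifP => // /(fintype.subsetP SB)/m0 mi.
  by rewrite mulr_ge0 // divr_ge0 // ltW.
- move=> i iS; have iB := fintype.subsetP SB _ iS.
  rewrite betaB // mulrC; apply: ler_pM => //.
  + by rewrite divr_ge0 // ltW.
  + exact: m0.
  + exact: le_trans (mb _ iB) (bu _ iB).
split.
  have -> : \sum_(i in S) beta i = \sum_(i in B) beta i.
    rewrite [RHS](big_setID S) /= (setIidPr SB) [X in _ + X]big1 ?addr0 // => i.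
    by rewrite inE ffunE => /andP[/negPf-> _].
  rewrite (eq_bigr (fun i => m i * (X / M))) => [|i /betaB//].
  by rewrite -mulr_suml mulrCA mulfV ?mulr1 // gt_eqF.
apply: le_trans (EMD_le tr) _.
have -> : \sum_(v in J) \sum_(i in B) f v i * d v i =
    \sum_(v in J) \sum_(i in B) f1 v i * d v i +
    \sum_(v in J) \sum_(i in B) rest v * (m i / M) * d v i.
  rewrite -big_split /=; apply: eq_bigr => v _; rewrite -big_split /=.
  by apply: eq_bigr => i _; rewrite mulrDl.
(* A unit goes from [v] through [i] and [j] to [i']. The legs up to [j] are charged to [x], since
   the [b i' j] sum to at most 1; the last leg is charged to [b], since [a j <= 1]. *)
have first_part : \sum_(v in J) \sum_(i in B) f1 v i * d v i <=
    serve_cost + \sum_(i in B) \sum_(j in C) b i j * d i j.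
  apply: (@le_trans _ _ (\sum_(v in J) \sum_(i' in B) \sum_(j in C)
      \sum_(i in U I near [set v])
         x i j * b i' j * ((d i j + d (near i) i) + d i' j))).
    apply: ler_sum => v vJ; apply: ler_sum => i' i'B.
    rewrite mulr_suml; apply: ler_sum => j jC; rewrite !mulr_suml.
    apply: ler_sum => i; rewrite !inE => /andP[iF /eqP nE].
    rewrite ler_wpM2l ?mulr_ge0 ?x_ge0 ?b0 // nE.
    have t1 := dist_triangle (CFC (JC vJ)) (FFC iF) (FFC (BF i'B)).
    have t2 := dist_triangle (FFC iF) (CFC jC) (FFC (BF i'B)).
    rewrite (dist_sym (CFC jC) (FFC (BF i'B))) in t2.
    by move: t1 t2; lra.
  have -> : \sum_(v in J) \sum_(i' in B) \sum_(j in C) \sum_(i in U I near [set v])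
         x i j * b i' j * ((d i j + d (near i) i) + d i' j) =
      \sum_(j in C) (\sum_(i' in B) b i' j) *
                    (\sum_(i in B) x i j * (d i j + d (near i) i)) +
      \sum_(j in C) a j * \sum_(i' in B) b i' j * d i' j.
    rewrite exchange_big /=.
    under eq_bigr do rewrite exchange_big /=.
    rewrite exchange_big /= -big_split /=; apply: eq_bigr => j jC.
    rewrite [X in _ = _ + X]mulr_sumr mulr_suml -big_split /=.
    apply: eq_bigr => i' i'B.
    rewrite -sum_U_partition mulr_sumr /client_share mulr_suml -big_split /=.
    by apply: eq_bigr => i iB; ring.
  rewrite lerD //.
    rewrite /serve_cost exchange_big /=; apply: ler_sum => j jC.
    rewrite ler_piMl ?b1 //; apply: sumr_ge0 => i iB.
    by rewrite mulr_ge0 ?x_ge0 ?BF // addr_ge0 ?near_ge0 // d_ge0 ?BF.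
  rewrite [leRHS]exchange_big /=; apply: ler_sum => j jC.
  rewrite ler_piMl ?a1 //; apply: sumr_ge0 => i iB.
  by rewrite mulr_ge0 ?b0 ?d_ge0 ?BF.
(* The rest goes from [v] to [near i], at most [diam], and then to [i]; this last leg is again
   charged to [b]. *)
have second_part : \sum_(v in J) \sum_(i in B) rest v * (m i / M) * d v i <=
    (X - M) * diam + \sum_(i in B) \sum_(j in C) b i j * d (near i) i.
  apply: (@le_trans _ _ (\sum_(v in J) \sum_(i in B)
      rest v * (m i / M) * (diam + d (near i) i))).
    apply: ler_sum => v vJ; apply: ler_sum => i iB.
    rewrite ler_wpM2l //; first by rewrite mulr_ge0 // divr_ge0 ?m0 ?(ltW M0).
    have t1 := dist_triangle (CFC (JC vJ)) (CFC (JC (nearJ iB))) (FFC (BF iB)).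
    by have := diamJ _ _ vJ (nearJ iB); move: t1; lra.
  have -> : \sum_(v in J) \sum_(i in B) rest v * (m i / M) * (diam + d (near i) i) =
      (X - M) * diam + (X - M) * M^-1 * \sum_(i in B) m i * d (near i) i.
    transitivity ((X - M) * \sum_(i in B) (m i / M) * (diam + d (near i) i)).
      rewrite -sum_rest mulr_suml; apply: eq_bigr => v _; rewrite mulr_sumr.
      by apply: eq_bigr => i _; rewrite -!mulrA.
    rewrite -mulrA -mulrDr; congr (_ * _).
    rewrite -[X in _ = X + _]mul1r -MM mulr_suml mulr_sumr -big_split /=.
    by apply: eq_bigr => i _; ring.
  rewrite lerD2l; apply: (@le_trans _ _ (\sum_(i in B) m i * d (near i) i)).
    rewrite ler_piMl //; last by rewrite ler_pdivrMr // mul1r.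
    by apply: sumr_ge0 => i iB; rewrite mulr_ge0 ?m0 ?near_ge0.
  apply: ler_sum => i iB; rewrite -mulr_suml ler_wpM2r ?near_ge0 ?mb //.
have -> : \sum_(i in B) \sum_(j in C) b i j * (d i j + d (near i) i) =
    \sum_(i in B) \sum_(j in C) b i j * d i j +
    \sum_(i in B) \sum_(j in C) b i j * d (near i) i.
  rewrite -big_split /=; apply: eq_bigr => i _; rewrite -big_split /=.
  by apply: eq_bigr => j _; rewrite mulrDr.
by move: first_part second_part; lra.
Qed.

(** Every cell has y-value at least 1/2. Through [black_component_diam] this turns a bound on y_B
    into one on the diameter of [J]. *)
Lemma card_component_le : #|J|%:R / 2 <= y_set y B.
Proof.
rewrite /y_set sum_U_partition -sum1_card natr_sum mulr_suml.
apply: ler_sum => v /(fintype.subsetP JRs) vRs.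
by have [_] := U_y_ge_half LP rep closest vRs; rewrite -[1 / 2]/(1%:R / 2).
Qed.

Lemma x_set_component_gt0 : J != set0 -> 0 < X.
Proof.
move=> /set0Pn[v vJ]; rewrite x_set_alpha (bigD1 v) //=.
have UvF w i : i \in U I near [set w] -> i \in F by rewrite inE => /andP[].
apply: ltr_pwDl; last first.
  apply: sumr_ge0 => w _; apply: sumr_ge0 => i /UvF iF; apply: sumr_ge0 => j jC.
  exact: x_ge0.
have [half _] := U_y_ge_half LP rep closest (fintype.subsetP JRs _ vJ).
apply: (@lt_le_trans _ _ (1 / 2)); first by lra.
apply: (le_trans half); apply: ler_sum => i /UvF iF; rewrite big_set1.
rewrite (bigD1 v) ?JC //= lerDl; apply: sumr_ge0 => j /andP[jC _].
exact: x_ge0.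
Qed.

(** With one representative the loads are themselves the transport plan, so the cost is a linear
    function of them and [knapsack_round] applies, with capacities [kappa * u i]. *)
Lemma singleton_choice (v : T) (n : nat) (y' : T -> R) (kappa l : R) :
  J = [set v] -> 1 <= l -> 0 <= kappa ->
  {in B, forall i, 0 <= y' i <= 1} -> \sum_(i in B) y' i = n%:R ->
  {in B, forall i, \sum_(j in C) x i j <= kappa * (u i)%:R * y' i} ->
  exists p, local_solution ((1 + l^-1) * kappa) n ((1 + l) * (4 * D_set I x B)) p.
Proof.
move=> Jv l1 k0 y01 yn xu.
have vJ : v \in J by rewrite Jv inE.
have [||i iB|S [b [SB Sn [b0 bS] bu [sb cb]]]] := @knapsack_round R T B n y'
    (fun i => \sum_(j in C) x i j) (fun i => kappa * (u i)%:R) (fun i => d v i) l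
    l1 y01 _ _ _ yn.
- by move=> i iB; rewrite xu // andbT sumr_ge0 // => j jC; rewrite x_ge0 // BF.
- by move=> i iB; rewrite mulr_ge0.
- by apply: dist_ge0; [apply/CFC/JC|apply/FFC/BF].
pose beta : {ffun T -> R} := [ffun i => if i \in S then b i else 0].
have betaB i : i \in B -> beta i = b i.
  by move=> iB; rewrite ffunE; case: ifPn => // /bS->.
exists (S, beta); split=> //=.
- split=> i; last by rewrite ffunE => /negPf->.
  by rewrite ffunE; case: ifP => // /(fintype.subsetP SB)/b0.
- by move=> i iS; rewrite ffunE iS -mulrA bu.
have SBsum : \sum_(i in S) beta i = X.
  rewrite -[RHS]sb [RHS](big_setID S) /= (setIidPr SB) [X in _ = _ + X]big1 ?addr0.
    by apply: eq_bigr => i iS; rewrite ffunE iS.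
  by move=> i; rewrite inE => /andP[iS iB]; rewrite bS.
split=> //.
have tr : is_transport I near J (alpha I x near) beta (fun _ i => b i).
  split.
  - by move=> w i _ /b0.
  - by move=> w; rewrite {1}Jv inE => /eqP->; rewrite sb -[LHS]/X x_set_alpha Jv big_set1.
  - by move=> i iB; rewrite [in X in X <= _]Jv big_set1 betaB.
apply: le_trans (EMD_le tr) _; rewrite [X in X <= _](_ : _ = \sum_(i in B) b i * d v i).
  apply: (le_trans cb); rewrite ler_wpM2l //; first by lra.
  apply: le_trans serve_cost_le; apply: ler_sum => i iB.
  rewrite mulr_suml; apply: ler_sum => j jC; rewrite ler_wpM2l ?x_ge0 ?BF //.
  have -> : near i = v by have := nearJ iB; rewrite Jv inE => /eqP.
  by rewrite lerDr d_ge0 // BF.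
by rewrite (big_pred1 v) // => w; rewrite Jv inE.
Qed.

(* The routed amounts average to the sum of the a j ^ 2, which is X - pi_J: hence
   configurations routing less than (1 - 1/l) X have weight at most l pi_J / X. *)
Lemma config_choice (l1 n : nat) (l diam : R) z zi zij :
  config_feasible I x y l1 B z zi zij -> J != set0 -> 2 <= l ->
  l * pi_set I x near J / X <= 1 / 2 ->
  0 <= diam -> {in J &, forall v w, d v w <= diam} ->
  let s := Num.min #|B|%:R
             (y_set y B * (1 + 2 * l * pi_set I x near J / X)) in
  s < n.+1%:R -> (n <= #|B|)%N -> (n < l1)%N ->
  exists c p, [/\ local_solution (1 + 2 * l^-1) n c p, 0 <= c &
    (n.+1%:R - s) * c <=
      2 * n.+1%:R * (2 * serve_cost + pi_set I x near J * diam)].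
Proof.
move=> [z1 ziy zijx [zle zieq zijz ziju zbot]] Jn0 l2 pi_small diam0 diamJ s sn nB nl1.
have X0 := x_set_component_gt0 Jn0.
(* The chain [zij <= zi <= z] is indexed by clients; [v0] is a client at which to read off
   [zi <= z]. *)
have /set0Pn[v0 v0J] := Jn0; have v0C := JC v0J.
set PI := pi_set I x near J in s sn pi_small *.
set p := l * PI / X in pi_small.
set W0 := configs l1 B in z1 ziy zijx zle zieq zijz ziju.
have subB S : S \in W0 -> odflt B S \subset B.
  by case: S => [S|] /=; rewrite ?inE // => /andP[].
have zij0 S i j : S \in W0 -> i \in odflt B S -> j \in C -> 0 <= zij S i j.
  by move=> SW iS jC; have [] := zle _ SW _ _ iS jC.
have z0 S : S \in W0 -> 0 <= z S.
  move=> SW; apply: le_trans (zijz _ _ SW v0C); apply: sumr_ge0 => i iS.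
  exact: zij0.
have swap (h : option {set T} -> T -> R) :
    \sum_(S in W0) \sum_(i in odflt B S) h S i =
    \sum_(i in B) \sum_(S in W0 | i \in odflt B S) h S i.
  rewrite (exchange_big_dep (mem B)) //= => S i SW.
  exact: (fintype.subsetP (subB _ SW)).
have swapx (h : T -> T -> R) :
    \sum_(S in W0) \sum_(i in odflt B S) \sum_(j in C) h i j * zij S i j =
    \sum_(i in B) \sum_(j in C) h i j * x i j.
  rewrite swap; apply: eq_bigr => i iB; rewrite exchange_big /=.
  by apply: eq_bigr => j jC; rewrite -mulr_sumr zijx.
(* The demand routed under [S], weighted by [z S]. *)
pose Mz S := \sum_(i in odflt B S) \sum_(j in C) a j * zij S i j.
have a01 := client_share_itv.
have Mz_le S : S \in W0 -> 0 <= X * z S - Mz S.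
  move=> SW; rewrite subr_ge0 x_set_client_share /Mz exchange_big /= mulr_suml.
  apply: ler_sum => j jC; rewrite -mulr_sumr ler_wpM2l ?zijz //.
  by have /andP[] := a01 _ jC.
have sumMz : \sum_(S in W0) (X * z S - Mz S) = PI.
  rewrite sumrB -mulr_sumr z1 mulr1 (swapx (fun _ j => a j)) exchange_big /=.
  rewrite x_set_client_share /PI pi_set_client_share -sumrB.
  by apply: eq_bigr => j _; rewrite -mulr_sumr -/(a j); ring.
pose W := [set S in W0 | (1 - l^-1) * X * z S <= Mz S].
have WW0 S : S \in W -> S \in W0 by rewrite inE => /andP[].
have splitW (h : option {set T} -> R) : \sum_(S in W0) h S =
    \sum_(S in W) h S + \sum_(S in W0 :\: W) h S.
  rewrite (big_setID W) /=; congr (_ + _); apply: eq_bigl => S.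
  by rewrite inE [S \in W]inE andbA andbb.
have l0 : 0 < l by lra.
have li0 : 0 < l^-1 by rewrite invr_gt0.
set g := \sum_(S in W) z S.
have g_ge : 1 - p <= g.
  have : X / l * \sum_(S in W0 :\: W) z S <= PI.
    rewrite -sumMz (splitW (fun S => X * z S - Mz S)) mulr_sumr -[leLHS]add0r.
    rewrite lerD //; first by apply: sumr_ge0 => S /WW0/Mz_le.
    apply: ler_sum => S; rewrite in_setD => /andP[SW SW0].
    have lt : Mz S < (1 - l^-1) * X * z S by move: SW; rewrite inE SW0 /= -ltNge.
    by move: lt; rewrite mulrBl mul1r mulrBl; lra.
  have -> : \sum_(S in W0 :\: W) z S = 1 - g by rewrite -z1 (splitW z) addrAC subrr add0r.
  move=> le; suff : 1 - g <= p by lra.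
  by rewrite /p ler_pdivlMr //; move: le; rewrite mulrAC ler_pdivrMr //; lra.
have p0 : 0 <= p by rewrite divr_ge0 ?mulr_ge0 ?(ltW l0) ?(ltW X0) ?pi_set_ge0.
have g_half : 1 / 2 <= g by lra.
(* The last configuration constraint justifies counting bottom as [l1] facilities; as [n < l1], it
   cannot be selected. *)
pose N (S : option {set T}) : nat := if S is Some S' then #|S'| else l1.
have zN S : S \in W0 -> z S * (N S)%:R <= \sum_(i in odflt B S) zi S i.
  case: S => [S|] SW /=; last by rewrite mulrC.
  rewrite (eq_bigr (fun=> z (Some S))) => [|i iS]; last exact: zieq.
  by rewrite sumr_const mulr_natr.
have zi_le S i : S \in W0 -> i \in odflt B S -> zi S i <= z S.
  by move=> SW iS; have [_ []] := zle _ SW _ _ iS v0C.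
have yB0 : 0 <= y_set y B.
  by apply: le_trans card_component_le; rewrite divr_ge0.
(* One bound for each argument of the minimum in [s]: a configuration opens at most [#|B|]
   facilities, and y_B is divided by the surviving mass [g >= 1 - p], where (1 - p)(1 + 2p) >= 1
   because p <= 1/2. *)
have zNs : \sum_(S in W) z S * (N S)%:R <= g * s.
  have le1 : \sum_(S in W) z S * (N S)%:R <= g * #|B|%:R.
    rewrite mulr_suml; apply: ler_sum => S /WW0 SW.
    apply: (le_trans (zN _ SW)).
    apply: (@le_trans _ _ (\sum_(i in odflt B S) z S)).
      by apply: ler_sum => i iS; apply: zi_le.
    rewrite sumr_const -[leLHS]mulr_natr ler_wpM2l ?z0 // ler_nat subset_leq_card //.
    exact: subB.
  have le2 : \sum_(S in W) z S * (N S)%:R <= g * (y_set y B * (1 + 2 * l * PI / X)).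
    apply: (@le_trans _ _ (y_set y B)).
      have -> : y_set y B = \sum_(S in W0) \sum_(i in odflt B S) zi S i.
        by rewrite swap; apply: eq_bigr => i iB; rewrite ziy.
      apply: (@le_trans _ _ (\sum_(S in W0) z S * (N S)%:R)).
        rewrite (splitW (fun S => z S * (N S)%:R)) lerDl; apply: sumr_ge0 => S.
        by rewrite in_setD => /andP[_ SW]; rewrite mulr_ge0 ?z0.
      by apply: ler_sum => S; apply: zN.
    rewrite mulrCA ler_peMr //.
    have -> : 1 + 2 * l * PI / X = 1 + 2 * p by rewrite /p; ring.
    apply: (@le_trans _ _ ((1 - p) * (1 + 2 * p))).
      have -> : (1 - p) * (1 + 2 * p) = 1 + p * (1 - 2 * p) by ring.
      by rewrite lerDl mulr_ge0 //; lra.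
    by rewrite ler_wpM2r //; lra.
  by rewrite /s /Order.min; case: ifP.
pose q S := \sum_(i in odflt B S) \sum_(j in C) (d i j + d (near i) i) * zij S i j.
(* Divided by [z S], this is the cost bound that [config_solution] gives under [S]. *)
pose k S := z S * serve_cost + q S + (X * z S - Mz S) * diam.
have e0 i j : i \in B -> j \in C -> 0 <= d i j + d (near i) i.
  by move=> iB jC; rewrite addr_ge0 ?near_ge0 // d_ge0 // BF.
have serve0 : 0 <= serve_cost.
  apply: sumr_ge0 => i iB; apply: sumr_ge0 => j jC.
  by rewrite mulr_ge0 ?e0 // x_ge0 // BF.
have k0 S : S \in W0 -> 0 <= k S.
  move=> SW; rewrite addr_ge0 ?mulr_ge0 ?Mz_le // addr_ge0 ?mulr_ge0 ?z0 //.
  apply: sumr_ge0 => i iS; apply: sumr_ge0 => j jC; rewrite mulr_ge0 ?zij0 // e0 //.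
  exact: (fintype.subsetP (subB _ SW)).
have sumk : \sum_(S in W) k S <= 2 * serve_cost + PI * diam.
  apply: (@le_trans _ _ (\sum_(S in W0) k S)).
    rewrite (splitW k) lerDl; apply: sumr_ge0 => S.
    by rewrite in_setD => /andP[_]; apply: k0.
  rewrite /k 2!big_split /= -!mulr_suml z1 sumMz (swapx (fun i j => d i j + d (near i) i)).
  have -> : \sum_(i in B) \sum_(j in C) (d i j + d (near i) i) * x i j = serve_cost.
    by apply: eq_bigr => i _; apply: eq_bigr => j _; rewrite mulrC.
  by lra.
have g0 : 0 < g by lra.
have [S0 [S0W zS0 NS0 kS0]] := @markov_choice R _ W z k N s _ n
   (fun S SW => z0 _ (WW0 _ SW)) (fun S SW => k0 _ (WW0 _ SW)) g0 sn zNs sumk.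
case: S0 S0W zS0 NS0 kS0 => [S|] SW zS NS kS; last first.
  by move: NS; rewrite /= leqNgt nl1.
have SW0 := WW0 _ SW.
have SB : S \subset B := subB _ SW0.
have [|S' [SS' S'B S'n]] := @subset_extend T S B n SB; first by rewrite NS nB.
pose b i j := if i \in S then zij (Some S) i j / z (Some S) else 0.
have sumS (h : T -> R) : \sum_(i in B) (if i \in S then h i else 0) = \sum_(i in S) h i.
  rewrite (big_setID S) /= (setIidPr SB) [X in _ + X]big1 ?addr0.
    by apply: eq_bigr => i ->.
  by move=> i; rewrite inE => /andP[/negPf->].
have sumb (h : T -> T -> R) : \sum_(i in B) \sum_(j in C) h i j * b i j =
    (\sum_(i in S) \sum_(j in C) h i j * zij (Some S) i j) / z (Some S).
  rewrite mulr_suml -sumS; apply: eq_bigr => i _; rewrite /b; case: ifP => _.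
    by rewrite mulr_suml; apply: eq_bigr => j _; rewrite mulrA.
  by apply: big1 => j _; rewrite mulr0.
have zn0 : z (Some S) != 0 by rewrite gt_eqF.
have [|||||||beta sol] := @config_solution S' b l^-1 diam S'B X0.
- by rewrite (ltW li0) /= -[1 / 2]mul1r mul1r div1r lef_pV2 ?posrE.
- move=> i j iB jC; rewrite /b; case: ifP => // iS.
  by rewrite divr_ge0 ?zij0 // ltW.
- move=> i j iB jC iS'; rewrite /b; case: ifPn => // /(fintype.subsetP SS').
  by rewrite (negPf iS').
- move=> j jC; rewrite /b (sumS (fun i => zij (Some S) i j / z (Some S))).
  by rewrite -mulr_suml ler_pdivrMr // mul1r; apply: (zijz (Some S)).
- move=> i iB; rewrite /b; have [iS|_] := boolP (i \in S); last by rewrite big1.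
  rewrite -mulr_suml ler_pdivrMr // -(zieq _ SW0 _ iS).
  exact: (ziju (Some S)).
- exact: diamJ.
- rewrite (sumb (fun _ j => a j)) ler_pdivlMr //.
  by move: SW; rewrite inE => /andP[_].
exists (k (Some S) / z (Some S)), (S', beta); split.
- move: sol; rewrite S'n (sumb (fun _ j => a j)).
  set c1 := _ + _ + _; suff -> : c1 = k (Some S) / z (Some S) by [].
  rewrite /c1 /k -[\sum_(i in S) _]/(Mz (Some S)).
  have -> : \sum_(i in B) \sum_(j in C) b i j * (d i j + d (near i) i) =
      q (Some S) / z (Some S).
    rewrite -(sumb (fun i j => d i j + d (near i) i)).
    by apply: eq_bigr => i _; apply: eq_bigr => j _; rewrite mulrC.
  by field.
- by rewrite divr_ge0 ?k0 // ltW.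
- rewrite mulrA ler_pdivrMr //.
  (* The factor 2 pays for [g >= 1 / 2]. *)
  have h1 : (n.+1%:R - s) * k (Some S) <= 2 * (g * (n.+1%:R - s) * k (Some S)).
    rewrite -[g * _ * _]mulrA [leRHS]mulrA ler_peMl //; last by lra.
    by rewrite mulr_ge0 ?k0 // subr_ge0 ltW.
  apply: (le_trans h1).
  have -> : 2 * n.+1%:R * (2 * serve_cost + PI * diam) * z (Some S) =
      2 * (n.+1%:R * (2 * serve_cost + PI * diam) * z (Some S)) by ring.
  by rewrite ler_wpM2l.
Qed.

End LocalSolutions.

(** * The two regimes: one large cell, or small y-value *)

Section LocalDistribution.

Variables (R : realType) (T : finType) (I : instance R T).
Variables (x : T -> T -> R) (y : T -> R) (Rs : {set T}) (near : T -> T).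
Variables (es : seq (T * T)) (J : {set T}) (l l1 l2 : nat).

Local Notation F := (facilities I).
Local Notation C := (clients I).
Local Notation d := (dist I).
Local Notation B := (U I near J).
Local Notation X := (x_set x B C).
Local Notation PI := (pi_set I x near J).
Local Notation D := (D_set I x B).

Hypothesis LP : basic_LP_feasible I x y.
Hypothesis rep : is_representatives I x Rs.
Hypothesis closest : is_closest_rep I Rs near.
Hypothesis order : is_edge_order I Rs es.
Hypothesis Jblack : J \in black_components I y l near Rs es.
Hypothesis l_ge2 : (2 <= l)%N.

Let RsC : Rs \subset C.
Proof. by have [] := representativesP rep. Qed.

Let y_ge0 : {in F, forall i, 0 <= y i}.
Proof. by case: LP => _ _ _ _ [_ y01] i /y01/andP[]. Qed.

Let JRs : J \subset Rs. Proof. by have [] := black_component_sub Jblack. Qed.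

Let Jn0 : J != set0. Proof. by have [] := black_component_sub Jblack. Qed.

Let lR : 2 <= l%:R :> R. Proof. by rewrite ler_nat. Qed.

(** What [mix_local_solutions] asks for, apart from [0 <= c]: the common target of both regimes. *)
Definition mixable (kappa s c : R) : Prop :=
  exists t c0 c1, [/\ t%:R <= s < t.+1%:R,
    exists p0, local_solution I x near J kappa t c0 p0,
    t%:R < s -> exists p1, local_solution I x near J kappa t.+1 c1 p1,
    (t.+1%:R - s) * c0 <= c & (s - t%:R) * c1 <= c].

Let yB_le_card : y_set y B <= #|B|%:R.
Proof.
rewrite -sum1_card natr_sum; apply: ler_sum => i; rewrite inE => /andP[iF _].
by case: LP => _ _ _ _ [_ y01]; have /andP[] := y01 _ iF.
Qed.

Lemma big_component_mixable : 2 * l%:R < y_set y B ->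
  mixable ((1 + l%:R^-1) * (1 + l%:R^-1)) (y_set y B) ((1 + l%:R) * (4 * D)).
Proof.
move=> yl; have l_ge := lR; set s := y_set y B in yl *.
have [v Jv] : exists v, J = [set v].
  apply/cards1P; rewrite eqn_leq card_gt0 Jn0 andbT leqNgt; apply/negP => J1.
  have := black_component_y RsC y_ge0 order Jblack J1.
  by rewrite ltNge (ltW yl).
have D0 : 0 <= D := D_set_ge0 near J LP.
have c0 : 0 <= (1 + l%:R) * (4 * D) by rewrite !mulr_ge0 //; lra.
have s0 : 0 < s by lra.
have st := truncn_itv (ltW s0).
set t := Num.truncn s in st *; have /andP[ts st1] := st.
have tl : l%:R + 1 <= t%:R :> R.
  rewrite natr1 ler_nat -ltnS -(ltr_nat R) -natr1; apply: le_lt_trans st1.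
  by lra.
have t0 : 0 < t%:R :> R by lra.
have li0 : 0 < l%:R^-1 :> R by rewrite invr_gt0; lra.
have xu i : i \in B -> [/\ 0 <= y i, y i <= 1 &
    \sum_(j in C) x i j <= (capacity I i)%:R * y i].
  rewrite inE => /andP[iF _]; case: LP => _ _ _ xu [_ y01].
  by have /andP[? ?] := y01 _ iF; split=> //; apply: xu.
have l1' : 1 <= l%:R :> R by lra.
have k0 : 0 <= 1 + l%:R^-1 :> R by lra.
exists t, ((1 + l%:R) * (4 * D)), ((1 + l%:R) * (4 * D)); split=> //.
(* Only the openings shrink, by t / s, while [x] is kept; s < t + 1 and t >= l give s / t <= 1 +
   1/l. The second factor of [kappa] is the one lost in merging. *)
- apply: (singleton_choice LP rep closest JRs (y' := fun i => y i * (t%:R / s)) Jv l1' k0).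
  + move=> i /xu[yi0 yi1 _]; rewrite mulr_ge0 ?divr_ge0 ?(ltW t0) ?(ltW s0) //=.
    by rewrite mulr_ile1 ?divr_ge0 ?(ltW t0) ?(ltW s0) // ler_pdivrMr ?mul1r.
  + by rewrite -mulr_suml -/(y_set y B) -/s mulrC mulfVK // gt_eqF.
  + move=> i /xu[yi0 yi1 le]; apply: (le_trans le).
    have -> : (1 + l%:R^-1) * (capacity I i)%:R * (y i * (t%:R / s)) =
      (capacity I i)%:R * y i * ((1 + l%:R^-1) * t%:R / s) by ring.
    rewrite ler_peMr ?mulr_ge0 // ler_pdivlMr // mul1r mulrDl mul1r.
    have : 1 <= l%:R^-1 * t%:R :> R by rewrite mulrC ler_pdivlMr; lra.
    by move: st1; rewrite -natr1; lra.
- move=> ts_lt.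
  have sB : t.+1%:R <= #|B|%:R :> R.
    rewrite ler_nat -(ltr_nat R); exact: lt_le_trans ts_lt yB_le_card.
  have Bs : 0 < #|B|%:R - s by lra.
  (* Upwards, multiplying could push an opening above 1. Instead each moves the same fraction [th]
     of its way to 1, and no capacity is lost. *)
  pose th := (t.+1%:R - s) / (#|B|%:R - s).
  have th0 : 0 <= th by rewrite divr_ge0 //; lra.
  have th1 : th <= 1 by rewrite ler_pdivrMr //; lra.
  apply: (singleton_choice LP rep closest JRs (y' := fun i => y i + (1 - y i) * th) Jv l1' k0).
  + move=> i /xu[yi0 yi1 _].
    have : 0 <= (1 - y i) * th by rewrite mulr_ge0 // subr_ge0.
    have : (1 - y i) * th <= 1 - y i by rewrite ler_piMr // subr_ge0.
    by move: yi0; lra.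
  + rewrite big_split /= -mulr_suml sumrB -/(y_set y B) -/s sumr_const /th.
    by rewrite mulrC mulfVK ?gt_eqF //; lra.
  + move=> i /xu[yi0 yi1 le]; apply: (le_trans le).
    rewrite -mulrA; apply: (@le_trans _ _ ((capacity I i)%:R * (y i + (1 - y i) * th))).
      by rewrite ler_wpM2l // lerDl mulr_ge0 // subr_ge0.
    rewrite ler_peMl //; last by lra.
    by rewrite mulr_ge0 // addr_ge0 // mulr_ge0 // subr_ge0.
- by rewrite ler_piMl //; lra.
- by rewrite ler_piMl //; move: st1; rewrite -natr1; lra.
Qed.

Lemma small_component_mixable z zi zij : y_set y B <= 2 * l%:R ->
  (6 * l <= l1)%N -> (l ^ 3 <= l2)%N -> concentrated I x l2 near J ->
  config_feasible I x y l1 B z zi zij ->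
  mixable (1 + 2 * l%:R^-1)
    (Num.min #|B|%:R (y_set y B * (1 + 2 * l%:R * PI / X)))
    (600 * l%:R ^+ 2 * D).
Proof.
move=> yl ll1 ll2 conc conf; have l_ge := lR.
have X0 : 0 < X := x_set_component_gt0 LP rep closest JRs Jn0.
have PI0 : 0 <= PI := pi_set_ge0 near J LP.
have D0 : 0 <= D := D_set_ge0 near J LP.
have l0 : 0 < l%:R :> R by lra.
have pi_small : l%:R * PI / X <= 1 / 4.
  rewrite ler_pdivrMr //.
  have l2R : 4 * l%:R <= l2%:R :> R.
    rewrite -natrM ler_nat; apply: leq_trans ll2.
    by rewrite expnSr leq_mul2r (@leq_exp2r 2 l 2) // l_ge2 orbT.
  have : PI * (4 * l%:R) <= X.
    apply: (@le_trans _ _ (PI * l2%:R)); first by rewrite ler_wpM2l.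
    by rewrite -ler_pdivlMr //; lra.
  by lra.
have [[v w] /= vwJ vwmax] : exists2 e : T * T, e \in setX J J &
    {in setX J J, forall e', d e'.1 e'.2 <= d e.1 e.2}.
  have /set0Pn[r rJ] := Jn0.
  pose e := [arg max_(e > (r, r) in setX J J) d e.1 e.2]%O.
  exists e; rewrite /e; case: arg_maxP => //=; rewrite ?inE ?rJ //.
have [vJ wJ] : v \in J /\ w \in J by move: vwJ; rewrite inE => /andP[].
set diam := d v w in vwmax.
have FC c : c \in J -> c \in F :|: C.
  by move=> cJ; rewrite inE (fintype.subsetP RsC) ?orbT // (fintype.subsetP JRs).
have diam0 : 0 <= diam by apply: dist_ge0; apply: FC.
have diamJ : {in J &, forall a b, d a b <= diam}.
  by move=> a b aJ bJ; apply: (vwmax (a, b)); rewrite inE aJ bJ.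
have J0 : 0 < #|J|%:R :> R by rewrite ltr0n card_gt0.
have Jl : #|J|%:R <= 4 * l%:R :> R.
  by have := card_component_le LP rep closest JRs; lra.
have piDiam : PI * diam <= 40 * l%:R * D.
  (* [pi_set_sep] accepts any lower bound for the edges leaving [J]; this one also covers [J = Rs],
     where L(J) would be a minimum over nothing. *)
  have : PI * (diam / #|J|%:R) <= 10 * D.
    apply: (pi_set_sep LP rep closest JRs); first by rewrite divr_ge0.
    move=> a b aJ bJ; rewrite ler_pdivrMr // mulrC.
    exact: (black_component_diam RsC y_ge0 order Jblack).
  rewrite mulrA ler_pdivrMr // => /le_trans; apply.
  have : D * #|J|%:R <= D * (4 * l%:R) by rewrite ler_wpM2l.
  by lra.
have serve4 := serve_cost_le LP rep closest JRs.
set K0 := 2 * serve_cost I x near J + PI * diam.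
have K0le : K0 <= 44 * l%:R * D.
  have : 2 * D <= l%:R * D by rewrite ler_wpM2r.
  by rewrite /K0; move: serve4 piDiam; lra.
set s := Num.min _ _.
have yB0 : 0 <= y_set y B.
  by apply: le_trans (card_component_le LP rep closest JRs); rewrite divr_ge0.
have fac : 1 <= 1 + 2 * l%:R * PI / X.
  by rewrite lerDl divr_ge0 ?(ltW X0) // mulr_ge0 //; lra.
have ys : y_set y B <= s by rewrite le_min yB_le_card ler_peMr.
have sB : s <= #|B|%:R by rewrite ge_min lexx.
have s4 : s <= 4 * l%:R.
  apply: (@le_trans _ _ (y_set y B * (1 + 2 * l%:R * PI / X))).
    by rewrite ge_min lexx orbT.
  have : 2 * l%:R * PI / X <= 1 / 2.
    have -> : 2 * l%:R * PI / X = 2 * (l%:R * PI / X) by ring.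
    by move: pi_small; lra.
  move=> h; apply: (@le_trans _ _ (y_set y B * 2)); last by lra.
  by rewrite ler_wpM2l //; lra.
have s0 : 0 <= s by lra.
have st := truncn_itv s0; set t := Num.truncn s in st.
have /andP[ts st1] := st.
have tB : (t <= #|B|)%N by rewrite -(ler_nat R); lra.
have t4 : (t <= 4 * l)%N by rewrite -(ler_nat R) natrM; lra.
have t4R : t%:R <= 4 * l%:R :> R by lra.
(* Both sizes must stay below [l1], the size charged to bottom; this is the reason for the constant
   6. *)
have tl1 : (t.+1 < l1)%N.
  apply: leq_trans ll1; apply: (@leq_trans (4 * l + 2)); first by rewrite addn2 !ltnS.
  rewrite (mulnDl 4 2 l) leq_add2l leq_pmulr //.
  exact: leq_trans l_ge2.
have pi2 : l%:R * PI / X <= 1 / 2 by lra.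
have st2 : s < t.+2%:R by rewrite -natr1; lra.
have [c0 [p0 [sol0 c00 le0]]] := config_choice LP rep closest JRs conf Jn0 lR
  pi2 diam0 diamJ st1 tB (ltnW tl1).
rewrite -/s -/K0 in le0.
have K00 : 0 <= K0.
  have : 0 <= (t.+1%:R - s) * c0 by rewrite mulr_ge0 //; lra.
  by move=> /le_trans/(_ le0); rewrite pmulr_rge0 // mulr_gt0 // ltr0n.
(* Here n <= 4l + 2 <= 5l, and 2 * 5 * 44 = 440 <= 600. *)
have bound n : n%:R <= 4 * l%:R + 2 :> R -> 2 * n%:R * K0 <= 600 * l%:R ^+ 2 * D.
  move=> nl; apply: (@le_trans _ _ (2 * (5 * l%:R) * (44 * l%:R * D))).
    apply: ler_pM => //; last by rewrite ler_wpM2l //; lra.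
    by rewrite mulr_ge0.
  rewrite expr2; have : 0 <= l%:R * l%:R * D by rewrite !mulr_ge0 // ltW.
  by lra.
have [st_le|ts_lt] := leP s t%:R.
  exists t, c0, 0; split=> //.
  - by exists p0.
  - by move=> /lt_le_trans/(_ st_le); rewrite ltxx.
  - by apply: (le_trans le0); apply: bound; rewrite -natr1; lra.
  - by rewrite mulr0 !mulr_ge0 // exprn_ge0 // ltW.
have tB1 : (t < #|B|)%N by rewrite -(ltr_nat R); lra.
have [c1 [p1 [sol1 c10 le1]]] := config_choice LP rep closest JRs conf Jn0 lR
  pi2 diam0 diamJ st2 tB1 tl1.
rewrite -/s -/K0 in le1.
exists t, c0, c1; split=> //.
- by exists p0.
- by exists p1.
- by apply: (le_trans le0); apply: bound; rewrite -natr1; lra.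
(* As s < t + 1, the factor t + 2 - s exceeds 1 while s - t is below 1. *)
- apply: (@le_trans _ _ ((t.+2%:R - s) * c1)).
    by rewrite ler_wpM2r //; move: st1; rewrite -!natr1; lra.
  by apply: (le_trans le1); apply: bound; rewrite -!natr1; lra.
Qed.

End LocalDistribution.

(* l0, c1, c2 : how large l and the constants hidden in l1 = Theta(l) and
   l2 = Theta(l^3) have to be; K : the constant hidden in every O(.) of the
   conclusion. *)
Theorem theorem4p4 :
  exists l0 c1 c2 : nat, forall C1 C2 : nat, exists K : nat,
  forall (l l1 l2 : nat),
    (l0 <= l)%N ->
    (c1 * l <= l1 <= C1 * l)%N ->
    (c2 * l ^ 3 <= l2 <= C2 * l ^ 3)%N ->
  forall (R : realType) (T : finType) (I : instance R T)
         (x : T -> T -> R) (y : T -> R),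
    basic_LP_feasible I x y ->
  forall (Rs : {set T}) (near : T -> T) (es : seq (T * T)),
    is_representatives I x Rs ->
    is_closest_rep I Rs near ->
    is_edge_order I Rs es ->
  forall J : {set T},
    J \in black_components I y l near Rs es ->
    concentrated I x l2 near J ->
  let B := U I near J in
  let C := clients I in
    (exists z zi zij, config_feasible I x y l1 B z zi zij) ->
  exists phi : {fsfun ({set T} * {ffun T -> R})%type -> R with 0},
    let s := expectation phi (fun p => #|p.1|%:R) in
    is_distribution phi /\
    (* S is a subset of B, and beta is a nonnegative vector indexed by B
       (extended by 0 outside B) *)
    (forall S beta, (S, beta) \in finsupp phi ->
       [/\ S \subset B, {in B, forall i, 0 <= beta i} &
           forall i, i \notin B -> beta i = 0]) /\
    (* (1) *)
    (y_set y B <= s /\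
     s <= y_set y B *
          (1 + 2 * l%:R * pi_set I x near J / x_set x B C) /\
     (2 * l%:R < y_set y B -> s = y_set y B)) /\
    (forall S beta, (S, beta) \in finsupp phi ->
       [/\ (* (2) *)
           #|S|%:Z = Num.floor s \/ #|S|%:Z = Num.ceil s,
           (* (3) *)
           {in S, forall i,
              beta i <= (1 + K%:R / l%:R) * (capacity I i)%:R} /\
           {in B :\: S, forall i, beta i = 0} &
           (* (4) *)
           \sum_(i in S) beta i = x_set x B C /\
           x_set x B C = \sum_(v in J) alpha I x near v]) /\
    (* (5) *)
    (#|` finsupp phi| <= (#|facilities I| + #|C|) ^ (K * l))%N /\
    (* (6) *)
    expectation phi (fun p => EMD I near J (alpha I x near) p.2)
      <= K%:R * l%:R ^+ 4 * D_set I x B.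
Proof.
(* The largest demand on the last constant is 1200, twice the 600 of the small regime; the rest is
   slack. *)
exists 2, 6, 1 => C1 C2; exists 2000.
move=> l l1 l2 l_ge2 /andP[ll1 _] /andP[ll2 _] R T I x y LP Rs near es rep closest.
move=> order J Jblack conc B C [z [zi [zij conf]]].
rewrite mul1n in ll2.
have [JRs Jn0] := black_component_sub Jblack.
have lR : 2 <= l%:R :> R by rewrite ler_nat.
have l0 : 0 < l%:R :> R by lra.
have X0 : 0 < x_set x B C := x_set_component_gt0 LP rep closest JRs Jn0.
have PI0 : 0 <= pi_set I x near J := pi_set_ge0 near J LP.
have D0 : 0 <= D_set I x B := D_set_ge0 near J LP.
have yB0 : 0 <= y_set y B.
  by apply: le_trans (card_component_le LP rep closest JRs); rewrite divr_ge0.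
have fac : 1 <= 1 + 2 * l%:R * pi_set I x near J / x_set x B C.
  by rewrite lerDl divr_ge0 ?(ltW X0) // mulr_ge0 //; lra.
have li0 : 0 < l%:R^-1 :> R by rewrite invr_gt0.
have li1 : l%:R^-1 <= 1 / 2 :> R by rewrite div1r lef_pV2 ?posrE.
have [s [kappa [c [[s_lo s_up s_eq] kappa_le c_bnd [t [c0 [c1 [st ex0 ex1 le0 le1]]]]]]]] :
  exists s kappa c : R,
    [/\ [/\ y_set y B <= s,
            s <= y_set y B * (1 + 2 * l%:R * pi_set I x near J / x_set x B C) &
            2 * l%:R < y_set y B -> s = y_set y B],
        kappa <= 1 + 2000%:R / l%:R,
        0 <= c /\ c + c <= 2000%:R * l%:R ^+ 4 * D_set I x B &
        mixable I x near J kappa s c].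
  have l24 : l%:R ^+ 2 * D_set I x B <= l%:R ^+ 4 * D_set I x B.
    by rewrite ler_wpM2r // ler_weXn2l //; lra.
  have l20 : 0 <= l%:R ^+ 2 * D_set I x B by rewrite mulr_ge0 // exprn_ge0 // ltW.
  have [big|small] := ltP (2 * l%:R) (y_set y B).
    exists (y_set y B), ((1 + l%:R^-1) * (1 + l%:R^-1)), ((1 + l%:R) * (4 * D_set I x B)).
    split; last exact: (big_component_mixable LP rep closest order Jblack l_ge2).
    - by split=> //; rewrite ler_peMr.
    - have : l%:R^-1 * l%:R^-1 <= l%:R^-1 * 1 :> R by rewrite ler_wpM2l ?(ltW li0) //; lra.
      by rewrite mulrDl mulrDr; lra.
    - split; first by rewrite !mulr_ge0 //; lra.
      have : 2 * (l%:R * D_set I x B) <= l%:R ^+ 2 * D_set I x B.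
        by rewrite mulrA ler_wpM2r // expr2 ler_wpM2r // ltW.
      have : 2 * D_set I x B <= l%:R * D_set I x B by rewrite ler_wpM2r.
      by lra.
  exists (Num.min #|B|%:R (y_set y B * (1 + 2 * l%:R * pi_set I x near J / x_set x B C))),
    (1 + 2 * l%:R^-1), (600 * l%:R ^+ 2 * D_set I x B).
  split; last exact: (small_component_mixable LP rep closest order Jblack l_ge2
    small ll1 ll2 conc conf).
  - split=> //.
      rewrite le_min ler_peMr // andbT -sum1_card natr_sum.
      apply: ler_sum => i; rewrite inE => /andP[iF _].
      by case: LP => _ _ _ _ [_ y01]; have /andP[] := y01 _ iF.
    by rewrite ge_min lexx orbT.
  - by lra.
  - by split; [rewrite -mulrA mulr_ge0|lra].
have [phi [dphi supp Ecard card2 Eemd]] :=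
  mix_local_solutions st ex0 ex1 le0 le1 (proj1 c_bnd).
exists phi; rewrite Ecard; split=> //; split.
  move=> S beta /supp[[n [e [SB _ [b0 bS] _ _]]] _]; split=> // i iB.
  by rewrite bS //; apply: contra iB; apply: (fintype.subsetP SB).
split=> //; split.
  move=> S beta /supp[[n [e [/= SB _ [b0 bS] bu [sb _]]]] fc]; split=> //.
    split=> [i iS|i]; last by rewrite inE => /andP[/bS].
    by apply: (le_trans (bu _ iS)); rewrite ler_wpM2r.
  by split=> //; apply: x_set_alpha.
split; last exact: le_trans Eemd (proj2 c_bnd).
(* [J] provides a client, and a served client forces a facility, so the base of the power is at
   least 2. *)
apply: (leq_trans card2).
have /set0Pn[v vJ] := Jn0.
have [RsC _ _] := representativesP rep.
have vC : v \in C by apply: (fintype.subsetP RsC); apply: (fintype.subsetP JRs).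
have F0 : (0 < #|facilities I|)%N.
  rewrite card_gt0; apply/eqP => F0; case: LP => _ /(_ _ vC) + _ _ _.
  by rewrite F0 big_set0 => /eqP; rewrite eq_sym oner_eq0.
have C0 : (0 < #|C|)%N by rewrite card_gt0; apply/set0Pn; exists v.
apply: (@leq_trans (#|facilities I| + #|C|) ); first by rewrite -(addn1 1) leq_add.
have Kl : (0 < 2000 * l)%N by rewrite muln_gt0 (ltnW l_ge2).
by rewrite -[leqLHS]expn1; apply: leq_pexp2l Kl; rewrite addn_gt0 F0.
Qed.
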